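(* Let $G$ be a countable discrete group with no non-trivial finite subgroups and let $\omega\in\beta G$. Then $I(\mathcal{A}_\omega)=B(\ell^2(G))$ if and only if $\omega$ is non-recurrent.
   Context: $G$ is a countable discrete group with identity $1$, $\{e_g\}_{g\in G}$ is the canonical orthonormal basis of $\ell^2(G)$, and $U_g=\lambda(g)$ is the left regular representation, $U_g e_h = e_{gh}$. $\mathcal{D} = \{M_f : f \in \ell^\infty(G)\}\subseteq B(\ell^2(G))$ is the algebra of diagonal (multiplication) operators, identified with $\ell^\infty(G) \equiv C(\beta G)$, where $\beta G$ is the Stone-Cech compactification of $G$; the continuous extension of $f$ to $\beta G$ is again denoted $f$. Left multiplication $g_1\mapsto g g_1$ extends to a homeomorphism of $\beta G$, written $\omega\mapsto g\cdot\omega$, giving an action of $G$ on $\beta G$. For $\omega\in\beta G$, $\pi_\omega:\mathcal{D}\to\mathcal{D}$ is the $*$-homomorphism $\pi_\omega(M_f)=M_{h}$ with $h(g)=f(g\cdot\omega)$. $\mathcal{D}\times_r G$ denotes the C*-subalgebra of $B(\ell^2(G))$ generated by $\mathcal{D}$ and $\{U_g:g\in G\}$, and $\pi_\omega\times\lambda:\mathcal{D}\times_r G\to B(\ell^2(G))$ is the $*$-homomorphism with $\pi_\omega\times\lambda(\sum_n M_{f_n}U_{g_n})=\sum_n\pi_\omega(M_{f_n})U_{g_n}$ for finite (or norm convergent) sums. Put $\mathcal{A}_\omega=\pi_\omega\times\lambda(\mathcal{D}\times_r G)\subseteq B(\ell^2(G))$. For a unital C*-subalgebra $\mathcal{A}\subseteq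 B(\mathcal{H})$, $I(\mathcal{A})$ denotes the injective envelope of $\mathcal{A}$. A minimal $\mathcal{A}$-projection is a completely positive idempotent map $\phi:B(\mathcal{H})\to B(\mathcal{H})$ fixing $\mathcal{A}$ elementwise and minimal among all such maps (for the order $\phi\le\psi$ iff $\phi\circ\psi=\psi\circ\phi=\phi$); the ranges of minimal $\mathcal{A}$-projections are all completely isometrically isomorphic to $I(\mathcal{A})$ via maps fixing $\mathcal{A}$ elementwise, and are called the copies of the injective envelope of $\mathcal{A}$ in $B(\mathcal{H})$. The equality $I(\mathcal{A}_\omega)=B(\ell^2(G))$ means that $B(\ell^2(G))$, with the inclusion $\mathcal{A}_\omega\subseteq B(\ell^2(G))$, is the injective envelope of $\mathcal{A}_\omega$. The point $\omega$ is non-recurrent if there is an open neighborhood $U$ of $\omega$ in $\beta G$ such that $g\cdot\omega\notin U$ for all $g\in G$, $g\neq1$. *)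

(* Defs.v *)
From HB Require Import structures.
From mathcomp Require Import all_boot all_order all_algebra.
From mathcomp Require Import all_classical all_reals all_analysis.
From mathcomp Require Import complex.
From mathcomp Require summability.
From mathcomp Require Import ring.

Set Implicit Arguments.
Unset Strict Implicit.
Unset Printing Implicit Defensive.

Import Order.TTheory GRing.Theory Num.Theory.
Import numFieldNormedType.Exports.

Local Open Scope classical_set_scope.
Local Open Scope ring_scope.

(* Naming R[i] as a numClosedFieldType gives it the topology that the library
   attaches to every numFieldType. *)
Definition Cplx (R : realType) : numClosedFieldType := R[i]%C.

Definition cabs (R : realType) (z : Cplx R) : R := Normc.normc z.

Lemma cabs_ge0 (R : realType) (z : Cplx R) : 0 <= cabs z.
Proof. by case: z => a b; exact: sqrtr_ge0. Qed.

Section HilbertSpace.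
Context {R : realType} {X : choiceType}.
Local Notation C := (Cplx R).

Definition nsq (f : X -> C) : \bar R :=
  \esum_(g in [set: X]) (cabs (f g) ^+ 2)%:E.

Lemma nsq_ge0 f : (0 <= nsq f)%E.
Proof. by apply: esum_ge0 => g _; rewrite lee_fin sqr_ge0. Qed.

Lemma le_nsq_mul (B : R) (h f k : X -> C) : 0 <= B ->
  (forall g, cabs (h g) <= B) -> (forall g, k g = h g * f g) ->
  (nsq k <= (B ^+ 2)%:E * nsq f)%E.
Proof.
move=> B0 hB kE; apply: ge_ereal_sup => _ [A [finA _] <-].
apply: (@le_trans _ _ ((B ^+ 2)%:E * \sum_(i \in A) (cabs (f i) ^+ 2)%:E)%E).
  rewrite !fsbig_finite//= !sumEFin -EFinM lee_fin mulr_sumr.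
  apply: ler_sum => i _.
  by rewrite kE /cabs Normc.normcM exprMn ler_wpM2r ?sqr_ge0//
             ler_sqr ?nnegrE ?cabs_ge0//; exact: hB.
apply: lee_wpmul2l; first by rewrite lee_fin sqr_ge0.
by apply: ereal_sup_ubound; exists A.
Qed.

Lemma le_nsqD (f g : X -> C) :
  (nsq (f + g)%R <= 2%:E * nsq f + 2%:E * nsq g)%E.
Proof.
apply: ge_ereal_sup => _ [A [finA _] <-].
apply: (@le_trans _ _ (2%:E * \sum_(i \in A) (cabs (f i) ^+ 2)%:E +
                       2%:E * \sum_(i \in A) (cabs (g i) ^+ 2)%:E)%E).
  rewrite !fsbig_finite//= !sumEFin -!EFinM -EFinD lee_fin !mulr_sumr.
  rewrite -big_split/=; apply: ler_sum => i _.
  have := le_normcD (f i) (g i); rewrite -[Normc.normc (f i)]/(cabs (f i)).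
  rewrite -[Normc.normc (g i)]/(cabs (g i)) => D.
  apply: (@le_trans _ _ ((cabs (f i) + cabs (g i)) ^+ 2)).
    by rewrite ler_sqr ?nnegrE ?cabs_ge0 ?addr_ge0 ?cabs_ge0.
  rewrite -subr_ge0 (_ : _ - _ = (cabs (f i) - cabs (g i)) ^+ 2) ?sqr_ge0//.
  by rewrite sqrrD sqrrB !mulr_natl; ring.
by apply: leeD; (apply: lee_wpmul2l; first by rewrite lee_fin);
  apply: ereal_sup_ubound; exists A.
Qed.

Definition sqsummable : {pred X -> C} := [pred f | (nsq f < +oo)%E].

Lemma sqsummable_submod_closed : submod_closed sqsummable.
Proof.
split=> [|a f g]; rewrite !inE.
  rewrite /nsq esum1 ?ltry// => i _.
  by rewrite /cabs Normc.normc0 expr0n.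
move=> f2 g2; apply: (le_lt_trans (le_nsqD _ _)).
have af2 : (nsq (a *: f)%R < +oo)%E.
  apply: (le_lt_trans (@le_nsq_mul (cabs a) (cst a) f _ _ _ _)) => //.
    exact: cabs_ge0.
  by apply: lte_mul_pinfty; rewrite ?lee_fin ?sqr_ge0.
by apply: lte_add_pinfty; apply: lte_mul_pinfty; rewrite ?lee_fin.
Qed.

HB.instance Definition _ :=
  GRing.isSubmodClosed.Build _ _ sqsummable sqsummable_submod_closed.

Record l2 := L2 { l2val :> X -> C ; l2valP : l2val \in sqsummable }.

HB.instance Definition _ := [isSub for l2val].
HB.instance Definition _ := [Choice of l2 by <:].
HB.instance Definition _ := [SubChoice_isSubLmodule of l2 by <:].

Definition l2norm (x : l2) : R := Num.sqrt (fine (nsq x)).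

(* Linear in the first argument. *)
Definition l2inner (x y : l2) : C :=
  summability.sum (fun g => x g * (y g)^* : C).

Definition bounded_linear : {pred l2 -> l2} := [pred T : l2 -> l2 |
  `[< linear T /\ exists M : R, forall x, l2norm (T x) <= M * l2norm x >]].

Lemma nsq_l2norm (x : l2) : nsq x = (l2norm x ^+ 2)%:E.
Proof.
have xoo : nsq x \is a fin_num by rewrite ge0_fin_numE ?nsq_ge0//; exact: l2valP.
by rewrite /l2norm sqr_sqrtr ?fine_ge0 ?nsq_ge0// fineK.
Qed.

Lemma bounded_linearP (T : l2 -> l2) : T \in bounded_linear <->
  linear T /\ exists2 M : R, 0 <= M & forall x, (nsq (T x) <= M%:E * nsq x)%E.
Proof.
rewrite inE; split=> [[Tlin [M TM]]|[Tlin [M M0 TM]]].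
  split=> //; exists (M ^+ 2) => [|x]; first exact: sqr_ge0.
  rewrite !nsq_l2norm -EFinM lee_fin -exprMn ler_sqr ?nnegrE ?sqrtr_ge0//.
  by rewrite (le_trans _ (TM x)) ?sqrtr_ge0.
split=> //; exists (Num.sqrt M) => x.
rewrite -(@ler_sqr R) ?nnegrE ?mulr_ge0 ?sqrtr_ge0// exprMn (sqr_sqrtr M0).
by have := TM x; rewrite !nsq_l2norm -EFinM lee_fin.
Qed.

Lemma bounded_linear_submod_closed : submod_closed bounded_linear.
Proof.
split=> [|a S T].
  apply/bounded_linearP; split=> [b x y|]; first by rewrite scaler0 addr0.
  exists 0 => // x; rewrite mul0e /nsq esum1// => i _.
  by rewrite /cabs Normc.normc0 expr0n.
move=> /bounded_linearP[Slin [M M0 SM]] /bounded_linearP[Tlin [N N0 TN]].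
apply/bounded_linearP; split=> [b x y|].
  rewrite !fctE /= Slin Tlin !scalerDr !scalerA mulrC -!addrA; congr (_ + _).
  by rewrite addrCA.
exists (2 * (cabs a ^+ 2 * M) + 2 * N) => [|x].
  by rewrite addr_ge0 ?mulr_ge0 ?cabs_ge0.
apply: (le_trans (le_nsqD (a *: (S x : X -> C)) (T x))).
rewrite (EFinD (2 * (cabs a ^+ 2 * M)) (2 * N)).
rewrite [leRHS]ge0_muleDl ?lee_fin ?mulr_ge0 ?cabs_ge0//.
apply: leeD; rewrite (EFinM 2) -muleA; apply: lee_wpmul2l; rewrite ?lee_fin//.
rewrite EFinM -muleA.
apply: (le_trans (@le_nsq_mul (cabs a) (cst a) (S x) _ _ _ _)) => //.
  exact: cabs_ge0.
by apply: lee_wpmul2l; rewrite ?lee_fin ?sqr_ge0.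
Qed.

HB.instance Definition _ :=
  GRing.isSubmodClosed.Build _ _ bounded_linear bounded_linear_submod_closed.

Record bop := Bop { bopval :> l2 -> l2 ; bopvalP : bopval \in bounded_linear }.

HB.instance Definition _ := [isSub for bopval].
HB.instance Definition _ := [Choice of bop by <:].
HB.instance Definition _ := [SubChoice_isSubLmodule of bop by <:].

Lemma bop_comp_subproof (S T : bop) : S \o T \in bounded_linear.
Proof.
have /bounded_linearP[Slin [M M0 SM]] := bopvalP S.
have /bounded_linearP[Tlin [N N0 TN]] := bopvalP T.
apply/bounded_linearP; split=> [b x y /=|]; first by rewrite Tlin Slin.
exists (M * N) => [|x /=]; first exact: mulr_ge0.
apply: (le_trans (SM _)); rewrite EFinM -muleA.
by apply: lee_wpmul2l; rewrite ?lee_fin.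
Qed.

Definition bop_comp (S T : bop) : bop := Bop (bop_comp_subproof S T).

Definition opnorm (T : bop) : R :=
  sup [set l2norm (T x) | x in [set x | l2norm x <= 1]].

(* Used as a relation between T and its Hilbert space adjoint S. *)
Definition is_adjoint (T S : bop) :=
  forall x y, l2inner (T x) y = l2inner x (S y).

(* A matrix of operators acts on the Hilbert sum of n copies of l2. *)

Definition tuple_norm n (x : 'I_n -> l2) : R :=
  Num.sqrt (\sum_i l2norm (x i) ^+ 2).

Definition mx_app n (T : 'M[bop]_n) (x : 'I_n -> l2) (i : 'I_n) : l2 :=
  \sum_j T i j (x j).

Definition mx_opnorm n (T : 'M[bop]_n) : R :=
  sup [set tuple_norm (mx_app T x) | x in [set x | tuple_norm x <= 1]].

(* In the order of a numClosedFieldType, 0 <= z says that z is real and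
   nonnegative. *)
Definition mx_positive n (T : 'M[bop]_n) :=
  forall x : 'I_n -> l2, 0 <= \sum_i l2inner (mx_app T x i) (x i).

Definition completely_positive (phi : bop -> bop) :=
  linear phi /\
  forall n (T : 'M[bop]_n), mx_positive T -> mx_positive (map_mx phi T).

Definition norm_closed (A : set bop) := forall T,
  (forall e : R, 0 < e -> exists2 S, A S & opnorm (T - S) < e) -> A T.

Definition cstar_subalgebra (A : set bop) :=
  [/\ A 0 /\ forall (a : C) S T, A S -> A T -> A (a *: S + T),
      forall S T, A S -> A T -> A (bop_comp S T),
      forall S T, is_adjoint S T -> A S -> A T &
      norm_closed A].

Definition cstar_generated (B : set bop) : set bop :=
  smallest cstar_subalgebra B.

(* A *-homomorphism defined on the C*-subalgebra A; the values of pi outside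
   of A are irrelevant. *)
Definition star_homomorphism_on (A : set bop) (pi : bop -> bop) :=
  [/\ forall (a : C) S T, A S -> A T -> pi (a *: S + T) = a *: pi S + pi T,
      forall S T, A S -> A T -> pi (bop_comp S T) = bop_comp (pi S) (pi T) &
      forall S T, A S -> is_adjoint S T -> is_adjoint (pi S) (pi T)].

Definition fixes (A : set bop) (phi : bop -> bop) := forall T, A T -> phi T = T.

Definition is_projection (A : set bop) (phi : bop -> bop) :=
  [/\ completely_positive phi, phi \o phi = phi & fixes A phi].

Definition projection_le (phi psi : bop -> bop) :=
  phi \o psi = phi /\ psi \o phi = phi.

Definition minimal_projection (A : set bop) (phi : bop -> bop) :=
  is_projection A phi /\
  forall psi, is_projection A psi -> projection_le psi phi -> psi = phi.

(* Psi restricts to a linear completely isometric map from E onto F. *)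
Definition complete_isometry_onto (E F : set bop) (Psi : bop -> bop) :=
  [/\ forall (a : C) S T, E S -> E T -> Psi (a *: S + T) = a *: Psi S + Psi T,
      forall n (T : 'M[bop]_n), (forall i j, E (T i j)) ->
        mx_opnorm (map_mx Psi T) = mx_opnorm T &
      Psi @` E = F].

(* F, with the inclusion of A, is the injective envelope of A: the range of a
   minimal A-projection is a copy of the injective envelope, and F is
   completely isometrically isomorphic to it by a map fixing A. *)
Definition is_injective_envelope (A F : set bop) :=
  exists phi, minimal_projection A phi /\
  exists Psi, complete_isometry_onto (range phi) F Psi /\ fixes A Psi.

End HilbertSpace.

Arguments l2 : clear implicits.
Arguments bop : clear implicits.

Section StoneCech.
Context {T : choiceType}.

(* The Stone-Cech compactification of the discrete space T is the space of
   ultrafilters on T; the sets of all ultrafilters containing a given A are a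
   base of its topology, and the points of T are the principal ultrafilters. *)
Record beta := Beta { ufilter : set_system T ; ufilterP : UltraFilter ufilter }.

HB.instance Definition _ := gen_eqMixin beta.
HB.instance Definition _ := gen_choiceMixin beta.

Definition beta_base (A : set T) : set beta := [set w | ufilter w A].

Lemma beta_base_cover : \bigcup_(A in [set: set T]) beta_base A = setT.
Proof.
apply/seteqP; split=> // w _; exists setT => //=.
by have := ufilterP w => ?; exact: filterT.
Qed.

Lemma beta_base_join A B w : [set: set T] A -> [set: set T] B ->
  beta_base A w -> beta_base B w ->
  exists D, [/\ [set: set T] D, beta_base D w &
                beta_base D `<=` beta_base A `&` beta_base B].
Proof.
move=> _ _ wA wB; exists (A `&` B); split=> //.
  by have := ufilterP w => ?; exact: filterI.
move=> v vAB; have := ufilterP v => ?; split; apply: filterS vAB.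
- exact: subIsetl.
- exact: subIsetr.
Qed.

HB.instance Definition _ :=
  isBaseTopological.Build beta beta_base_cover beta_base_join.

(* The value at w of the continuous extension of a bounded f. *)
Definition beta_ext (R : realType) (f : T -> Cplx R) (w : beta) : Cplx R :=
  lim (f @ ufilter w).

Lemma beta_map_subproof (s : T -> T) (w : beta) : UltraFilter (s @ ufilter w).
Proof.
have wU := ufilterP w; split=> [|F FF sF].
  exact: fmap_proper_filter.
apply/seteqP; split=> // A FA.
have [//|wA] := in_ultra_setVsetC (s @^-1` A) wU.
have /filter_ex[t []//] : F (A `&` ~` A) by apply: filterI => //; exact: sF.
Qed.

(* The continuous extension of s : T -> T to the compactification. *)
Definition beta_map (s : T -> T) (w : beta) : beta := Beta (beta_map_subproof s w).

End StoneCech.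

Arguments beta : clear implicits.

Section GroupAlgebra.
Context {R : realType} {G : groupType}.
Local Notation C := (Cplx R).

Definition beta_act (g : G) : beta G -> beta G := beta_map (fun h => (g * h)%g).

Definition non_recurrent (w : beta G) := exists U : set (beta G),
  [/\ open U, U w & forall g : G, g <> 1%g -> ~ U (beta_act g w)].

Definition bounded_function (f : G -> C) := exists M : R, forall g, cabs (f g) <= M.

Record linf := Linf { linfval :> G -> C ; linfP : bounded_function linfval }.

Lemma mulop_sqsummable (f : linf) (x : l2 R G) :
  (fun g => f g * x g) \in sqsummable.
Proof.
have [M fM] := linfP f; rewrite inE.
have M0 : 0 <= M by rewrite (le_trans _ (fM 1%g)) ?cabs_ge0.
apply: (le_lt_trans (@le_nsq_mul _ _ M f x _ _ _ _)) => //.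
by rewrite nsq_l2norm -EFinM ltry.
Qed.

Lemma mulop_bounded (f : linf) :
  (fun x => L2 (mulop_sqsummable f x)) \in bounded_linear.
Proof.
have [M fM] := linfP f.
have M0 : 0 <= M by rewrite (le_trans _ (fM 1%g)) ?cabs_ge0.
apply/bounded_linearP; split=> [a x y|].
  apply/val_inj/funext => g /=.
  by rewrite !fctE/= mulrDr; congr (_ + _); exact: mulrCA.
exists (M ^+ 2) => [|x]; first exact: sqr_ge0.
exact: (@le_nsq_mul _ _ M f x).
Qed.

Definition mulop (f : linf) : bop R G := Bop (mulop_bounded f).

Lemma nsq_transl (g : G) (f : G -> C) :
  nsq (fun h => f (g^-1 * h)%g) = nsq f.
Proof.
rewrite /nsq [RHS](@reindex_esum R G G setT setT (fun h => g^-1 * h)%g)//.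
split=> // [x y _ _ /mulgI//|y _]; exists (g * y)%g => //.
by rewrite mulKg.
Qed.

Lemma lreg_sqsummable (g : G) (x : l2 R G) :
  (fun h => x (g^-1 * h)%g) \in sqsummable.
Proof. by rewrite inE nsq_transl; exact: l2valP. Qed.

Lemma lreg_bounded (g : G) :
  (fun x => L2 (lreg_sqsummable g x)) \in bounded_linear.
Proof.
apply/bounded_linearP; split=> [a x y|]; first exact/val_inj.
by exists 1 => // x; rewrite mul1e /= nsq_transl.
Qed.

(* The left regular representation: it maps the basis vector e_h to e_(gh). *)
Definition lreg (g : G) : bop R G := Bop (lreg_bounded g).

Definition crossed_product : set (bop R G) :=
  cstar_generated (range mulop `|` range lreg).

Lemma pi_subproof (w : beta G) (f : linf) :
  bounded_function (fun g => beta_ext f (beta_act g w)).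
Proof.
have [M fM] := linfP f; exists (Num.max (M + 1) (cabs (point : C))) => g.
rewrite le_max /beta_ext; set F := ufilter _.
have FU : ProperFilter F := @ultra_proper _ _ (ufilterP _).
have [cvF|dvF] := pselect (cvg (f @ F)); last first.
  by apply/orP; right; rewrite dvgP.
apply/orP; left.
have /filter_ex[h /= fh] := @cvgr_dist_lt _ _ _ F FU f _ cvF _ ltr01.
have : `|lim (f @ F)| <= (cabs (f h) + 1)%:C%C :> C.
  rewrite rmorphD/= -[lim _](subrK (f h)) addrC.
  by apply: (le_trans (ler_normD _ _)); apply: lerD => //; exact: ltW.
by rewrite lecR => /le_trans; apply; rewrite lerD2r; exact: fM.
Qed.

(* The *-homomorphism pi_w on diagonal operators, on the level of functions. *)
Definition pi_fun (w : beta G) (f : linf) : linf := Linf (pi_subproof w f).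

Definition is_covariant_extension (w : beta G) (pi : bop R G -> bop R G) :=
  star_homomorphism_on crossed_product pi /\
  forall s : seq (linf * G),
    pi (\sum_(p <- s) bop_comp (mulop p.1) (lreg p.2)) =
    \sum_(p <- s) bop_comp (mulop (pi_fun w p.1)) (lreg p.2).

(* The *-homomorphism pi_w x lambda; only its values on the crossed product are
   determined, so the choice of an extension is immaterial. *)
Definition pi_lambda (w : beta G) : bop R G -> bop R G :=
  xget (fun=> 0) (is_covariant_extension w).

Definition orbit_algebra (w : beta G) : set (bop R G) :=
  pi_lambda w @` crossed_product.

End GroupAlgebra.

Definition no_nontrivial_finite_subgroup (G : groupType) :=
  forall H : set G, group_closed (mem H) -> finite_set H -> H = [set 1%g].

(* Main.v *)
Require Import Defs.
From mathcomp Require Import all_boot all_order all_algebra.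
From mathcomp Require Import finmap.
From mathcomp Require Import all_classical all_reals all_analysis.
From mathcomp Require Import complex.
From mathcomp Require summability.
From mathcomp Require Import ring lra.

Set Implicit Arguments.
Unset Strict Implicit.
Unset Printing Implicit Defensive.

Import Order.TTheory GRing.Theory Num.Theory.
Import numFieldNormedType.Exports.

Local Open Scope classical_set_scope.
Local Open Scope ring_scope.

(** Let [R_h] be the right translation by [h] and, for an ultrafilter [mu] on
    [G], put [Phi_mu T = lim_(h -> mu) R_h^-1 T R_h], a pointwise limit of
    matrix coefficients ([tlim]). This map is completely positive, commutes
    with the left translations [U_g], and sends [M_f X] to [M_h (Phi_mu X)] with
    [h g = f (g . mu)]. Hence [Phi_w] is multiplicative on the crossed product
    and realises [pi_w x lambda] ([tlim_covariant]). The statement speaks of an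
    arbitrary covariant extension, so that its continuity is also needed: a
    unital *-homomorphism on a C*-algebra is contractive, by a Neumann series
    ([star_homomorphism_contractive]).

    If [w] is non-recurrent, the characteristic function of a neighbourhood of
    [w] is sent by [pi_w] to that of the identity, so the orbit algebra contains
    all matrix units ([non_recurrent_matunit]). The only completely positive
    map that fixes them together with the unit is the identity
    ([fixes_matunits_id]); it is therefore the minimal projection, and its
    range is everything.

    If [w] is recurrent, each set of return times is infinite, since a finite
    one would shrink to the stabiliser of [w], a finite subgroup. The
    ultrafilters [e] with [e . w = w] that are not principal then form a
    nonempty compact semigroup, which contains an idempotent
    ([recurrent_idempotent]). Limits along products of ultrafilters are
    iterated limits, so [Phi_e] is idempotent; it fixes the orbit algebra
    because [e . w = w] ([tlim_fixes_orbit]); and it is not the identity,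
    because it moves the rank one projection at the identity of [G] to infinity.

    Such a projection cannot exist when [B(l2)] is a copy of the injective
    envelope ([envelope_rigid]). Indeed let [phi] be a minimal projection and
    [Psi] a complete isometry of its range onto [B(l2)] that fixes the algebra.
    Unital complete isometries are completely positive in both directions
    ([unital_contraction_positive]), so [Psi^-1 Phi_e Psi phi] is a projection
    below [phi]. By minimality it is [phi], and then [Phi_e] is the identity. *)

(** * Complex numbers and limits along ultrafilters *)

Lemma ultra_dichotomy T (F : set_system T) : ProperFilter F ->
  (forall A, F A \/ F (~` A)) -> UltraFilter F.
Proof.
move=> FP dich; split=> // F' F'P sF; apply/seteqP; split=> // A F'A.
have [//|FA] := dich A.
by have /filter_ex[t []//] : F' (A `&` ~` A) by apply: filterI => //; exact: sF.
Qed.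

Lemma ultra_fmap T U (f : T -> U) (F : set_system T) :
  UltraFilter F -> UltraFilter (f @ F).
Proof.
move=> FU; apply: ultra_dichotomy => A.
exact: (in_ultra_setVsetC (f @^-1` A) FU).
Qed.

Section ComplexNumbers.
Context {R : realType}.
Local Notation C := (Cplx R).
Implicit Types z u v : C.

Definition ofR (r : R) : C := r%:C%C.
Definition reC z : R := complex.Re z.
Definition imC z : R := complex.Im z.

Lemma normCE z : `|z| = ofR (cabs z).
Proof. by case: z. Qed.

Lemma le_cabsD u v : cabs (u + v) <= cabs u + cabs v.
Proof. exact: le_normcD. Qed.
Lemma cabsN z : cabs (- z) = cabs z.
Proof. exact: normcN. Qed.
Lemma cabs0 : cabs (0 : C) = 0.
Proof. exact: Normc.normc0. Qed.
Lemma cabs1 : cabs (1 : C) = 1.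
Proof. exact: Normc.normc1. Qed.
Lemma cabsBC u v : cabs (u - v) = cabs (v - u).
Proof. by rewrite -cabsN opprB. Qed.
Lemma cabs0_eq0 z : cabs z = 0 -> z = 0.
Proof. exact: Normc.eq0_normc. Qed.
Lemma conjCE (a b : R) : Num.conj (a +i* b : C)%C = (a -i* b)%C.
Proof. by []. Qed.
Lemma dist_cabs u v : `|cabs u - cabs v| <= cabs (u - v).
Proof.
rewrite ler_norml lerBlDr lerNl opprB lerBlDr; apply/andP; split.
  by rewrite cabsBC; apply: (le_trans _ (le_cabsD _ _)); rewrite subrK.
by apply: (le_trans _ (le_cabsD _ _)); rewrite subrK.
Qed.
Lemma cabsJ z : cabs (z^*) = cabs z.
Proof. by case: z => a b; rewrite /cabs /Normc.normc/= sqrrN. Qed.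
Lemma cabs_ofR (r : R) : cabs (ofR r) = `|r|.
Proof. by rewrite /cabs /Normc.normc/= expr0n/= addr0 sqrtr_sqr. Qed.
Lemma mulCJ z : z * z^* = ofR (cabs z ^+ 2).
Proof.
case: z => a b; rewrite /cabs /Normc.normc sqr_sqrtr ?addr_ge0 ?sqr_ge0//.
by apply/eqP; rewrite eq_complex/=; apply/andP; split; apply/eqP; ring.
Qed.
Lemma sqr_cabs z : cabs z ^+ 2 = reC z ^+ 2 + imC z ^+ 2.
Proof. by case: z => a b; rewrite /cabs /Normc.normc sqr_sqrtr ?addr_ge0 ?sqr_ge0. Qed.
Lemma reC_le z : `|reC z| <= cabs z.
Proof.
by rewrite -(@ler_sqr R) ?nnegrE ?cabs_ge0// sqr_cabs real_normK ?num_real// lerDl sqr_ge0.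
Qed.
Lemma imC_le z : `|imC z| <= cabs z.
Proof.
by rewrite -(@ler_sqr R) ?nnegrE ?cabs_ge0// sqr_cabs real_normK ?num_real// lerDr sqr_ge0.
Qed.
Lemma cabs_le_reim z : cabs z <= `|reC z| + `|imC z|.
Proof.
rewrite -(@ler_sqr R) ?nnegrE ?cabs_ge0 ?addr_ge0// sqr_cabs sqrrD.
rewrite !real_normK ?num_real//.
by rewrite [leRHS]addrAC lerDl mulrn_wge0// mulr_ge0.
Qed.
Lemma ofR_ge0 (r : R) : (0 <= ofR r) = (0 <= r).
Proof. by rewrite /ofR lecE/= eqxx. Qed.
Lemma ge0C z : 0 <= z -> z = ofR (reC z) /\ 0 <= reC z.
Proof. by case: z => a b; rewrite lecE/= => /andP[/eqP-> ->]. Qed.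
Lemma geC0 z : imC z = 0 -> 0 <= reC z -> 0 <= z.
Proof. by case: z => a b /= -> a0; rewrite lecE/= eqxx. Qed.

Lemma reCD u v : reC (u + v) = reC u + reC v. Proof. by case: u v => ? ? [? ?]. Qed.
Lemma imCD u v : imC (u + v) = imC u + imC v. Proof. by case: u v => ? ? [? ?]. Qed.
Lemma reCN u : reC (- u) = - reC u. Proof. by case: u => ? ?. Qed.
Lemma imCN u : imC (- u) = - imC u. Proof. by case: u => ? ?. Qed.

Lemma ofRD r s : ofR (r + s) = ofR r + ofR s.
Proof. exact: rmorphD. Qed.
Lemma ofRM r s : ofR (r * s) = ofR r * ofR s.
Proof. exact: rmorphM. Qed.
Lemma conj_ofR r : (ofR r)^* = ofR r.
Proof. by rewrite /ofR conjCE oppr0. Qed.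
Lemma ofR_inj : injective ofR.
Proof. exact: complexI. Qed.

Section Limits.
Context {T : Type} (F : set_system T).

Lemma cvgCP {FF : Filter F} (f : T -> C) (l : C) :
  f @ F --> l <-> forall e : R, 0 < e -> \forall x \near F, cabs (f x - l) < e.
Proof.
split=> [/cvgrPdist_lt fl e e0|H].
  have := fl (ofR e); rewrite ltcR => /(_ e0).
  by apply: filterS => x; rewrite normCE ltcR cabsBC.
apply/cvgrPdist_lt => e e0.
have [eE re] := ge0C (ltW e0); move: e0; rewrite eE ltcR => e0.
apply: filterS (H _ e0) => x xe.
by rewrite normCE ltcR cabsBC.
Qed.

Lemma cvg_conj {FF : Filter F} (f : T -> C) (l : C) :
  f @ F --> l -> (fun x => (f x)^*) @ F --> l^*.
Proof.
move/cvgCP => fl; apply/cvgCP => e /fl; apply: filterS => x.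
by rewrite -rmorphB/= cabsJ.
Qed.

Lemma cvgC_add {FF : Filter F} (f g : T -> C) (a b : C) :
  f @ F --> a -> g @ F --> b -> (fun x => f x + g x) @ F --> (a + b : C).
Proof. by move=> fa gb; exact: (@cvgD (Cplx R) (Cplx R) T F FF f g a b fa gb). Qed.

Lemma cvgC_mul {FF : Filter F} (f g : T -> C) (a b : C) :
  f @ F --> a -> g @ F --> b -> (fun x => f x * g x) @ F --> (a * b : C).
Proof. by move=> fa gb; exact: (@cvgM (Cplx R) T F FF f g a b fa gb). Qed.

Lemma cvgC_cst {FF : Filter F} (a : C) : (fun _ : T => a) @ F --> a.
Proof. exact: cvg_cst. Qed.

Lemma cvgC_sum {FF : Filter F} I (s : seq I) (P : pred I) (f : I -> T -> C) (a : I -> C) :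
  (forall i, f i @ F --> a i) ->
  (fun x => \sum_(i <- s | P i) f i x) @ F --> (\sum_(i <- s | P i) a i : C).
Proof.
move=> fa; elim: s => [|i s IH].
  rewrite big_nil (_ : (fun _ => _) = fun=> 0); first exact: cvgC_cst.
  by apply/funext => x; rewrite big_nil.
rewrite big_cons; case: (boolP (P i)) => Pi.
  rewrite (_ : (fun _ => _) = fun x => f i x + \sum_(j <- s | P j) f j x).
    exact: (@cvgC_add FF (f i) _ (a i) _ (fa i) IH).
  by apply/funext => x; rewrite big_cons Pi.
rewrite (_ : (fun _ => _) = fun x => \sum_(j <- s | P j) f j x)//.
by apply/funext => x; rewrite big_cons (negbTE Pi).
Qed.

Lemma cvg_cabs {FF : Filter F} (f : T -> C) (l : C) :
  f @ F --> l -> (fun x => cabs (f x)) @ F --> cabs l.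
Proof.
move/cvgCP => fl; apply/cvgrPdist_lt => e /fl; apply: filterS => x.
by apply: le_lt_trans; rewrite cabsBC dist_cabs.
Qed.

Lemma cvgC_unique {FF : ProperFilter F} (f : T -> C) (l l' : C) :
  f @ F --> l -> f @ F --> l' -> l = l'.
Proof. by move=> h1 h2; exact: (@cvg_unique _ (@norm_hausdorff _ _) _ _ l l' h1 h2). Qed.

Lemma cvgC_lim {FF : ProperFilter F} (f : T -> C) (l : C) :
  f @ F --> l -> lim (f @ F) = l.
Proof. by move=> h; apply: cvg_lim => //; exact: norm_hausdorff. Qed.

Lemma ge0_cvgC {FF : ProperFilter F} (f : T -> C) (l : C) :
  (forall x, 0 <= f x) -> f @ F --> l -> 0 <= l.
Proof.
move=> f0 /cvgCP fl.
have key e : 0 < e -> exists2 r : R, 0 <= r & cabs (ofR r - l) < e.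
  move=> /fl /filter_ex[x xe]; have [E r0] := ge0C (f0 x).
  by exists (reC (f x)) => //; rewrite -E.
apply: geC0.
  apply/eqP; rewrite -normr_eq0 eq_le normr_ge0 andbT; apply/ler_addgt0Pr => e e0.
  rewrite add0r; have [r _ h] := key e e0; apply: ltW; apply: le_lt_trans h.
  by apply: le_trans (imC_le _); rewrite imCD imCN /imC /= add0r normrN.
apply/ler_addgt0Pr => e e0; have [r r0 h] := key e e0.
have := le_trans (ler_norm _) (reC_le (ofR r - l)).
rewrite reCD reCN /reC /= => h2; lra.
Qed.

Lemma cvgC_mull {FF : Filter F} (c : C) (f : T -> C) (a : C) :
  f @ F --> a -> (fun x => c * f x) @ F --> (c * a : C).
Proof. by move=> fa; exact: (@cvgMr (Cplx R) T F FF f c a fa). Qed.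

(** By compactness of real intervals, applied to real and imaginary parts. *)
Lemma ultra_bounded_cvg {FU : UltraFilter F} (f : T -> C) (M : R) :
  (forall x, cabs (f x) <= M) -> cvg (f @ F).
Proof.
move=> fM.
have FP := @ultra_proper _ F FU.
have key (h : T -> R) : (forall x, `|h x| <= M) -> exists l : R, h @ F --> l.
  move=> hM; have := @segment_compact R (- M) M; rewrite compact_ultra.
  have FhM : (h @ F) `[- M, M]%classic.
    by rewrite /=; apply: filterE => x /=; rewrite in_itv/= -ler_norml.
  by move=> /(_ (h @ F) (ultra_fmap h FU) FhM)[l [_ hl]]; exists l.
have [|a ha] := key (reC \o f).
  by move=> x; apply: (le_trans (reC_le _)); exact: fM.
have [|b hb] := key (imC \o f).
  by move=> x; apply: (le_trans (imC_le _)); exact: fM.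
apply/cvg_ex; exists (a +i* b : C)%C; apply/cvgCP => e e0.
have e2 : 0 < e / 2 by rewrite divr_gt0.
have /cvgrPdist_lt/(_ _ e2) := ha; have /cvgrPdist_lt/(_ _ e2) := hb.
apply: filterS2 => x xb xa; apply: (le_lt_trans (cabs_le_reim _)).
rewrite reCD reCN imCD imCN [ltRHS]splitr; apply: ltrD.
  by rewrite distrC.
by rewrite distrC.
Qed.

End Limits.
End ComplexNumbers.

(** * Sesquilinear forms and inner product spaces *)

Section SesquilinearForms.
Context {R : realType}.
Local Notation C := (Cplx R).
Context {V : lmodType C} (B : V -> V -> C).
Hypothesis Bl : forall a x y z, B (a *: x + y) z = a * B x z + B y z.
Hypothesis Br : forall a x y z, B x (a *: y + z) = a^* * B x y + B x z.
Hypothesis B_ge0 : forall x, 0 <= B x x.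

(** A form with real diagonal is hermitian: polarise with [1] and [i]. *)
Lemma form_herm x y : B y x = (B x y)^*.
Proof.
have im0 z : imC (B z z) = 0 by have [-> _] := ge0C (B_ge0 z).
have h1 : imC (B (1 *: x + y) (1 *: x + y)) = 0 by exact: im0.
have h2 : imC (B ((0 +i* 1)%C *: x + y) ((0 +i* 1)%C *: x + y)) = 0 by exact: im0.
move: h1 h2 (im0 x) (im0 y); rewrite !(Bl, Br).
case: (B x x) => a b; case: (B x y) => c d; case: (B y x) => e f.
case: (B y y) => g h; rewrite rmorph1 !mul1r !conjCE /= => h1 h2 h3 h4.
by apply/eqP; rewrite eq_complex/=; apply/andP; split; apply/eqP; lra.
Qed.

(** Only semidefinite positivity is assumed, as this will be applied to the
    forms of positive operators. *)
Lemma form_CS x y : cabs (B x y) ^+ 2 <= reC (B x x) * reC (B y y).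
Proof.
have [xE p0] := ge0C (B_ge0 x); have [yE c0] := ge0C (B_ge0 y).
set p := reC _ in xE p0 *; set c := reC _ in yE c0 *.
set q := cabs _ ^+ 2; have q0 : 0 <= q by exact: sqr_ge0.
(* positivity at x - s B(x,y) y, for real s *)
have key s : 0 <= p - 2 * s * q + s ^+ 2 * q * c.
  have := B_ge0 ((- (ofR s * B x y)) *: y + x).
  rewrite !(Bl, Br) (form_herm x y) xE yE rmorphN rmorphM/= conj_ofR.
  set b := B x y; have qE : b * b^* = ofR q by rewrite mulCJ.
  have -> : - (ofR s * b) * (- (ofR s * b^*) * ofR c + b^*) +
     (- (ofR s * b^*) * b + ofR p) =
     ofR s * ofR s * (b * b^*) * ofR c - 2 * ofR s * (b * b^*) + ofR p by ring.
  rewrite qE; have -> : (2 : C) = ofR 2 by rewrite /ofR rmorphD.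
  rewrite /ofR -!(rmorphM, rmorphB, rmorphD)/= -/(ofR _) ofR_ge0.
  by congr (_ <= _); ring.
have [c00|cn0] := eqVneq c 0.
  rewrite c00 mulr0 leNgt; apply/negP => q1.
  (* any s with 2 s q > p will do *)
  have := key ((p + 1) / (2 * q)); rewrite c00 mulr0 addr0.
  rewrite (_ : 2 * _ * q = p + 1); first by lra.
  by field; rewrite gt_eqF.
have c1 : 0 < c by rewrite lt_neqAle eq_sym cn0.
have := key c^-1; rewrite (_ : _ + _ = p - q / c); last by field.
by rewrite subr_ge0 ler_pdivrMr.
Qed.
End SesquilinearForms.

(** The axioms of an inner product space, with the norm as separate data. *)
Definition inner_space (R : realType) (V : lmodType (Cplx R))
    (ip : V -> V -> Cplx R) (nrm : V -> R) :=
  [/\ forall a x y z, ip (a *: x + y) z = a * ip x z + ip y z,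
      forall x y, ip y x = (ip x y)^*,
      forall x, 0 <= nrm x &
      forall x, ip x x = ofR (nrm x ^+ 2)].

Section InnerSpaces.
Context {R : realType}.
Local Notation C := (Cplx R).
Context {V : lmodType C} {ip : V -> V -> C} {nrm : V -> R}.
Hypothesis ipV : inner_space ip nrm.

Lemma ipl a x y z : ip (a *: x + y) z = a * ip x z + ip y z.
Proof. by case: ipV. Qed.
Lemma ipJ x y : ip y x = (ip x y)^*.
Proof. by case: ipV. Qed.
Lemma nrm_ge0 x : 0 <= nrm x.
Proof. by case: ipV. Qed.
Lemma ipxx x : ip x x = ofR (nrm x ^+ 2).
Proof. by case: ipV. Qed.
Lemma ipr a x y z : ip x (a *: y + z) = a^* * ip x y + ip x z.
Proof. by rewrite ipJ ipl rmorphD rmorphM/= -!ipJ. Qed.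
Lemma ip0l x : ip 0 x = 0.
Proof.
have := ipl 1 0 0 x; rewrite scaler0 addr0 mul1r => /eqP.
by rewrite -subr_eq0 opprD addNKr oppr_eq0 => /eqP.
Qed.
Lemma ipDl x y z : ip (x + y) z = ip x z + ip y z.
Proof. by rewrite -{1}[x]scale1r ipl mul1r. Qed.
Lemma ipZl a x z : ip (a *: x) z = a * ip x z.
Proof. by rewrite -[a *: x]addr0 ipl ip0l addr0. Qed.
Lemma ipNl x z : ip (- x) z = - ip x z.
Proof. by rewrite -scaleN1r ipZl mulN1r. Qed.
Lemma ipBl x y z : ip (x - y) z = ip x z - ip y z.
Proof. by rewrite ipDl ipNl. Qed.
Lemma ip0r x : ip x 0 = 0.
Proof. by rewrite ipJ ip0l rmorph0. Qed.
Lemma ipDr x y z : ip z (x + y) = ip z x + ip z y.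
Proof. by rewrite ipJ ipDl rmorphD/= -!ipJ. Qed.
Lemma ipZr a x z : ip z (a *: x) = a^* * ip z x.
Proof. by rewrite ipJ ipZl rmorphM/= -ipJ. Qed.
Lemma ipNr x z : ip z (- x) = - ip z x.
Proof. by rewrite ipJ ipNl rmorphN/= -ipJ. Qed.
Lemma ipBr x y z : ip z (x - y) = ip z x - ip z y.
Proof. by rewrite ipDr ipNr. Qed.
Lemma ip_suml I (r : seq I) (P : pred I) (F : I -> V) z :
  ip (\sum_(i <- r | P i) F i) z = \sum_(i <- r | P i) ip (F i) z.
Proof.
elim/big_rec2: _ => [|i a b _ <-]; first exact: ip0l.
exact: ipDl.
Qed.

Lemma ip_ge0 x : 0 <= ip x x.
Proof. by rewrite ipxx ofR_ge0 sqr_ge0. Qed.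

Lemma le_ip_nrm x y : cabs (ip x y) <= nrm x * nrm y.
Proof.
rewrite -(@ler_sqr R) ?nnegrE ?cabs_ge0 ?mulr_ge0 ?nrm_ge0// exprMn.
by have := form_CS ipl ipr ip_ge0 x y; rewrite !ipxx.
Qed.

Lemma nrm0 : nrm 0 = 0.
Proof.
have := ipxx 0; rewrite ip0l => /esym/(@ofR_inj _ _ 0)/eqP.
by rewrite sqrf_eq0 => /eqP.
Qed.

Lemma nrmD_sqr x y :
  nrm (x + y) ^+ 2 = nrm x ^+ 2 + 2 * reC (ip x y) + nrm y ^+ 2.
Proof.
apply: ofR_inj; rewrite -ipxx ipDl !ipDr !ipxx (ipJ x y) !ofRD addrA.
congr (_ + _); rewrite -addrA; congr (_ + _).
case: (ip x y) => a b; apply/eqP; rewrite eq_complex/=.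
by apply/andP; split; apply/eqP; ring.
Qed.

Lemma nrmZ a x : nrm (a *: x) = cabs a * nrm x.
Proof.
apply/eqP; rewrite -(@eqrXn2 _ 2) ?mulr_ge0 ?cabs_ge0 ?nrm_ge0//; apply/eqP.
rewrite exprMn; apply: ofR_inj.
by rewrite [RHS]ofRM -!ipxx ipZl ipZr mulrA mulCJ.
Qed.

Lemma nrmN x : nrm (- x) = nrm x.
Proof. by rewrite -scaleN1r nrmZ cabsN cabs1 mul1r. Qed.

Lemma le_nrmD x y : nrm (x + y) <= nrm x + nrm y.
Proof.
rewrite -(@ler_sqr R) ?nnegrE ?addr_ge0 ?nrm_ge0// nrmD_sqr sqrrD.
rewrite lerD2r lerD2l mulr_natl lerMn2r/=.
by apply: le_trans (le_ip_nrm x y); apply: le_trans (reC_le _); exact: ler_norm.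
Qed.

(** This is [T ^ 2 <= c T], obtained without square roots: it is Cauchy-Schwarz
    for the form [<T x, y>] at [y = T x]. *)
Lemma positive_nrm_sqr (T : V -> V) (c : R) : 0 <= c ->
  (forall a x y, T (a *: x + y) = a *: T x + T y) ->
  (forall x, 0 <= ip (T x) x) -> (forall x, nrm (T x) <= c * nrm x) ->
  forall x, nrm (T x) ^+ 2 <= c * reC (ip (T x) x).
Proof.
move=> c0 Tl Tpos Tc x.
have fl a u v z : ip (T (a *: u + v)) z = a * ip (T u) z + ip (T v) z.
  by rewrite Tl ipl.
have fr a u v z : ip (T u) (a *: v + z) = a^* * ip (T u) v + ip (T u) z.
  exact: ipr.
have := form_CS fl fr Tpos x (T x).
rewrite ipxx cabs_ofR ger0_norm ?sqr_ge0// -exprM.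
set n := nrm (T x); set r := reC (ip (T x) x) => h.
have r0 : 0 <= r by have [] := ge0C (Tpos x).
have h2 : reC (ip (T (T x)) (T x)) <= c * n ^+ 2.
  apply: le_trans (ler_norm _) _; apply: le_trans (reC_le _) _.
  apply: le_trans (le_ip_nrm _ _) _.
  by rewrite expr2 mulrA ler_wpM2r ?nrm_ge0.
have {h h2} : n ^+ 2 * n ^+ 2 <= (c * r) * n ^+ 2.
  rewrite -exprD; apply: (le_trans h).
  by rewrite (mulrC c) -mulrA ler_wpM2l.
have [->|n0] := eqVneq n 0; first by rewrite expr0n/= mulr_ge0.
by rewrite ler_pM2r// exprn_gt0// lt_neqAle eq_sym n0 nrm_ge0.
Qed.

(** The disks of centre [c + it] through [0] all contain the segment [[0, 2c]],
    hence the spectrum of [T]; here the corresponding norm estimate. *)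
Lemma positive_disk (T : V -> V) (c t : R) : 0 <= c ->
  (forall a x y, T (a *: x + y) = a *: T x + T y) ->
  (forall x, 0 <= ip (T x) x) -> (forall x, nrm (T x) <= c * nrm x) ->
  forall x, nrm ((c +i* t)%C *: x - T x) ^+ 2 <= (c ^+ 2 + t ^+ 2) * nrm x ^+ 2.
Proof.
move=> c0 Tl Tpos Tc x; have h := positive_nrm_sqr c0 Tl Tpos Tc x.
have [TxE r0] := ge0C (Tpos x); set r := reC _ in h TxE r0 *.
rewrite nrmD_sqr nrmN nrmZ exprMn ipNr ipZl (ipJ (T x) x) TxE conj_ofR.
have -> : cabs (c +i* t : C)%C ^+ 2 = c ^+ 2 + t ^+ 2 by rewrite sqr_cabs.
have -> : reC (- ((c +i* t)%C * ofR r)) = - (c * r).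
  by rewrite reCN /reC /= mulr0 subr0.
by have := mulr_ge0 c0 r0; lra.
Qed.
End InnerSpaces.

(** * The Hilbert space of square summable functions *)

Notation totally := summability.totally.
#[local] Existing Instance summability.totally_filter.

Section SquareSummable.
Context {R : realType} {X : choiceType}.
Local Notation C := (Cplx R).
Local Notation l2 := (l2 R X).

Definition psq (f : X -> C) (A : {fset X}) : R := \sum_(i <- A) cabs (f i) ^+ 2.

Lemma psq_ge0 f A : 0 <= psq f A.
Proof. by apply: sumr_ge0 => i _; exact: sqr_ge0. Qed.

Lemma big_fsetD (V : nmodType) (F : X -> V) (A B : {fset X}) : (A `<=` B)%fset ->
  \sum_(i <- B) F i = \sum_(i <- A) F i + \sum_(i <- (B `\` A)%fset) F i.
Proof.
move=> AB; rewrite (big_fsetID _ (mem A)) /=; congr (_ + _).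
  apply: eq_fbigl => x; rewrite !inE; case: (boolP (x \in A)) => xA; rewrite ?andbF//.
  by rewrite (fsubsetP AB).
by apply: eq_fbigl => x; rewrite !inE andbC.
Qed.

Lemma le_psq f (A B : {fset X}) : (A `<=` B)%fset -> psq f A <= psq f B.
Proof. by move=> AB; rewrite /psq (big_fsetD _ AB) lerDl psq_ge0. Qed.

Lemma psqE f (A : set X) : finite_set A ->
  (\sum_(i \in A) (cabs (f i) ^+ 2)%:E)%E = (psq f (fset_set A))%:E.
Proof. by move=> fA; rewrite fsbig_finite//= sumEFin. Qed.

Lemma psq_le_nsq f A : ((psq f A)%:E <= nsq f)%E.
Proof.
apply: ereal_sup_ubound; exists [set` A]; first by split => //; exact: finite_fset.
by rewrite psqE ?set_fsetK//; exact: finite_fset.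
Qed.

Lemma nsq_le f (c : R) : (forall A, psq f A <= c) -> (nsq f <= c%:E)%E.
Proof.
move=> fc; apply: ge_ereal_sup => _ [A [finA _] <-].
by rewrite psqE// lee_fin.
Qed.

Lemma psq_le_l2norm (x : l2) A : psq x A <= l2norm x ^+ 2.
Proof. by rewrite -lee_fin -nsq_l2norm psq_le_nsq. Qed.

Lemma l2norm_ge0 (x : l2) : 0 <= l2norm x.
Proof. exact: sqrtr_ge0. Qed.

Lemma l2norm_sqr_le (x : l2) (c : R) : (forall A, psq x A <= c) -> l2norm x ^+ 2 <= c.
Proof. by move=> /nsq_le; rewrite nsq_l2norm lee_fin. Qed.

Lemma l2norm_le (x : l2) (c : R) : 0 <= c -> (forall A, psq x A <= c ^+ 2) -> l2norm x <= c.
Proof.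
by move=> c0 /l2norm_sqr_le; rewrite ler_sqr// nnegrE// l2norm_ge0.
Qed.

Lemma sqsummable_psq (f : X -> C) (c : R) : (forall A, psq f A <= c) -> f \in sqsummable.
Proof. by move=> fc; rewrite inE (le_lt_trans (nsq_le fc))// ltry. Qed.

Definition mkl2 (f : X -> C) (c : R) (fc : forall A, psq f A <= c) : l2 :=
  L2 (sqsummable_psq fc).

Lemma l2_ext (x y : l2) : (forall g, x g = y g) -> x = y.
Proof. by move=> xy; apply: val_inj; apply: funext. Qed.

Lemma l2D (x y : l2) g : (x + y) g = x g + y g. Proof. by []. Qed.
Lemma l2Z a (x : l2) g : (a *: x) g = a * x g. Proof. by []. Qed.
Lemma l2N (x : l2) g : (- x) g = - x g. Proof. by []. Qed.

Lemma l2norm_approx (x : l2) (e : R) : 0 < e -> exists A, l2norm x ^+ 2 - e < psq x A.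
Proof.
move=> e0; apply: contrapT => /forallNP H.
suff : l2norm x ^+ 2 <= l2norm x ^+ 2 - e by rewrite lerBrDl gerDr leNgt e0.
by apply: l2norm_sqr_le => A; rewrite leNgt; apply/negP.
Qed.

Lemma partial_sumE (f : X -> C) (A : {fset X}) :
  summability.partial_sum f A = \sum_(i <- A) f i.
Proof. by rewrite /summability.partial_sum big_seq_fsetE. Qed.

Lemma ofR_sum I (r : seq I) (P : pred I) (F : I -> R) :
  ofR (\sum_(i <- r | P i) F i) = \sum_(i <- r | P i) ofR (F i).
Proof. by apply: big_morph => [x y|//]; exact: ofRD. Qed.

(** A net of partial sums of nonnegative terms converges to its supremum. *)
Lemma cvg_psq (x : l2) :
  (fun A : {fset X} => \sum_(i <- A) x i * (x i)^*) @ totally --> (ofR (l2norm x ^+ 2) : C).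
Proof.
apply/cvgCP => e e0; have [A Ae] := l2norm_approx x e0.
exists A => // B /= AB.
under eq_bigr do rewrite mulCJ.
rewrite -ofR_sum -[_ - _](_ : ofR (psq x B - l2norm x ^+ 2) = _); last first.
  by rewrite /ofR rmorphB.
rewrite cabs_ofR distrC ger0_norm ?subr_ge0 ?psq_le_l2norm//.
by rewrite ltrBlDl -ltrBlDr (lt_le_trans Ae)// le_psq.
Qed.

(** Reduces the convergence of inner products to that of squared norms. *)
Lemma polarization (u v : C) : let i : C := (0 +i* 1)%C in
  u * v^* = (ofR 4)^-1 * ((u + v) * (u + v)^* - (u - v) * (u - v)^*
    + i * ((u + i * v) * (u + i * v)^*) - i * ((u - i * v) * (u - i * v)^*)).
Proof.
move=> i; have ii : i * i = -1.
  by apply/eqP; rewrite eq_complex/=; apply/andP; split; apply/eqP; ring.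
have iJ : i^* = - i by rewrite /i conjCE; apply/eqP; rewrite eq_complex/= oppr0 !eqxx.
have n4 : ofR 4 != 0 :> C by rewrite /ofR -[0]/(ofR 0) (inj_eq (@complexI _)).
rewrite !(rmorphD, rmorphN, rmorphM)/= iJ; apply: (mulfI n4).
rewrite [RHS]mulrA mulfV// mul1r.
have -> : (ofR 4 : C) = 4 by rewrite /ofR rmorph_nat.
transitivity (2 * u * v^* + 2 * v * u^* - (2 * u * v^* - 2 * v * u^*) * (i * i)).
  by rewrite ii; ring.
ring.
Qed.

Lemma cvg_l2inner (x y : l2) :
  (fun A : {fset X} => \sum_(i <- A) x i * (y i)^*) @ totally --> l2inner x y.
Proof.
suff [l hl] : exists l : C, (fun A : {fset X} => \sum_(i <- A) x i * (y i)^*) @ totally --> l.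
  rewrite /l2inner /summability.sum (_ : summability.partial_sum _ =
    (fun A : {fset X} => \sum_(i <- A) x i * (y i)^*)); last first.
    by apply/funext => A; rewrite partial_sumE.
  by rewrite (cvgC_lim hl).
pose i : C := (0 +i* 1)%C.
exists ((ofR 4)^-1 * (ofR (l2norm (x + y) ^+ 2) - ofR (l2norm (x - y) ^+ 2) +
  i * ofR (l2norm (x + i *: y) ^+ 2) - i * ofR (l2norm (x - i *: y) ^+ 2))).
rewrite (_ : (fun A => _) = (fun A : {fset X} => (ofR 4)^-1 *
  (\sum_(g <- A) (x + y) g * ((x + y) g)^* - \sum_(g <- A) (x - y) g * ((x - y) g)^* +
   i * \sum_(g <- A) (x + i *: y) g * ((x + i *: y) g)^*
   - i * \sum_(g <- A) (x - i *: y) g * ((x - i *: y) g)^*) : C)).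
  apply: cvgMr; apply: cvgB; [apply: cvgD; [apply: cvgB|]|]; try exact: cvg_psq.
    by apply: cvgMr; exact: cvg_psq.
  by apply: cvgMr; exact: cvg_psq.
apply/funext => A; rewrite !mulr_sumr -!sumrN -!big_split/= mulr_sumr.
by apply: eq_bigr => g _; exact: polarization.
Qed.

Lemma l2_inner_space : inner_space (@l2inner R X) (@l2norm R X).
Proof.
split=> [a x y z|x y|x|x].
- apply: (cvgC_unique (F := totally)); first exact: cvg_l2inner.
  rewrite (_ : (fun A => _) = (fun A : {fset X} => a * (\sum_(i <- A) x i * (z i)^*) +
    \sum_(i <- A) y i * (z i)^* : C)).
    by apply: cvgD; [apply: cvgMr|]; exact: cvg_l2inner.
  apply/funext => A; rewrite mulr_sumr -big_split/=; apply: eq_bigr => g _.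
  by rewrite mulrA -mulrDl.
- apply: (cvgC_unique (F := totally)); first exact: cvg_l2inner.
  rewrite (_ : (fun A => _) = (fun A : {fset X} => (\sum_(i <- A) x i * (y i)^*)^* : C)).
    by apply: cvg_conj; exact: cvg_l2inner.
  apply/funext => A; rewrite rmorph_sum/=; apply: eq_bigr => g _.
  by rewrite rmorphM/= conjCK mulrC.
- exact: l2norm_ge0.
- by apply: (cvgC_unique (F := totally)); [exact: cvg_l2inner|exact: cvg_psq].
Qed.

Lemma l2norm_eq0 (x : l2) : l2norm x = 0 -> x = 0.
Proof.
move=> x0; apply: l2_ext => g; apply: cabs0_eq0; apply/eqP.
rewrite -sqrf_eq0 eq_le sqr_ge0 andbT.
have := psq_le_l2norm x [fset g]%fset.
by rewrite /psq big_seq_fset1 x0 expr0n.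
Qed.

Lemma cabs_le_l2norm (x : l2) g : cabs (x g) <= l2norm x.
Proof.
have := psq_le_l2norm x [fset g]%fset.
by rewrite /psq big_seq_fset1 ler_sqr ?nnegrE ?cabs_ge0 ?l2norm_ge0.
Qed.

Lemma trunc_subproof (x : l2) (A : {fset X}) (B : {fset X}) :
  psq (fun g => if g \in A then x g else 0) B <= l2norm x ^+ 2.
Proof.
apply: le_trans (psq_le_l2norm x B); apply: ler_sum => g _.
by case: ifP => // _; rewrite cabs0 expr0n sqr_ge0.
Qed.

Definition trunc (A : {fset X}) (x : l2) : l2 := mkl2 (trunc_subproof x A).

Lemma truncB (x : l2) A g : (x - trunc A x) g = if g \in A then 0 else x g.
Proof. by rewrite l2D l2N /=; case: ifP => _; rewrite ?subrr ?subr0. Qed.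

Lemma l2norm_trunc (x : l2) A : l2norm (x - trunc A x) ^+ 2 <= l2norm x ^+ 2 - psq x A.
Proof.
apply: l2norm_sqr_le => B.
rewrite lerBrDl; apply: le_trans (psq_le_l2norm x (A `|` B)%fset).
rewrite [leRHS]/psq (big_fsetD _ (fsubsetUl A B)) lerD2l.
have -> : ((A `|` B) `\` A = B `\` A)%fset by rewrite fsetDUl fsetDv fset0U.
rewrite /psq; under eq_bigr do rewrite truncB.
rewrite (big_fsetID _ (mem A)) /= big1_fset ?add0r.
  rewrite (_ : [fset x0 | x0 in B & x0 \notin A]%fset = (B `\` A)%fset); last first.
    by apply/fsetP => g; rewrite !inE andbC.
  rewrite le_eqVlt; apply/orP; left; apply/eqP.
  by apply: eq_fbigr => g; rewrite !inE => /andP[/negbTE -> _].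
by move=> g; rewrite !inE => /andP[_ ->] _; rewrite cabs0 expr0n.
Qed.

Lemma trunc_approx (x : l2) (e : R) : 0 < e ->
  exists A, forall B : {fset X}, (A `<=` B)%fset -> l2norm (x - trunc B x) < e.
Proof.
move=> e0; have e2 : 0 < e ^+ 2 by rewrite exprn_gt0.
have [A Ae] := l2norm_approx x e2; exists A => B AB.
rewrite -(@ltr_sqr R) ?nnegrE ?l2norm_ge0 ?(ltW e0)//.
apply: (le_lt_trans (l2norm_trunc _ _)); rewrite ltrBlDl -ltrBlDr.
by rewrite (lt_le_trans Ae)// le_psq.
Qed.

Lemma l2inner_trunc (x y : l2) A : l2inner x (trunc A y) = \sum_(g <- A) x g * (y g)^*.
Proof.
apply: (cvgC_unique (F := totally)); first exact: cvg_l2inner.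
apply: (@cvg_near_cst _ _ _ _ _ _).
exists A => // B /= AB; rewrite (big_fsetD _ AB) [X in _ + X]big1_fset ?addr0.
  by apply: eq_fbigr => g gA _ /=; rewrite gA.
by move=> g; rewrite !inE => /andP[/negbTE gA _] _ /=; rewrite gA rmorph0 mulr0.
Qed.

(** A single finite set serves all vectors [x] of the unit ball; this is what
    turns pointwise convergence into weak convergence. *)
Lemma l2inner_approx (y : l2) (e : R) : 0 < e -> exists A : {fset X}, forall x : l2,
  cabs (l2inner x y - \sum_(g <- A) x g * (y g)^*) <= e * l2norm x.
Proof.
move=> e0; have [A Ae] := trunc_approx y e0; exists A => x.
rewrite -l2inner_trunc -(ipBr l2_inner_space) [leRHS]mulrC.
apply: (le_trans (le_ip_nrm l2_inner_space _ _)).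
by rewrite ler_wpM2l ?l2norm_ge0// ltW// Ae.
Qed.

Lemma delta_subproof (a : X) (B : {fset X}) :
  psq (fun g => (g == a)%:R) B <= 1.
Proof.
rewrite /psq (big_fsetID _ (pred1 a)) /= [X in _ + X]big1_fset ?addr0.
  have [aB|aB] := boolP (a \in B).
    rewrite (_ : [fset x | x in B & x == a]%fset = [fset a]%fset).
      by rewrite big_seq_fset1 eqxx cabs1 expr1n.
    by apply/fsetP => g; rewrite !inE; case: eqP => [->|]; rewrite ?aB ?andbF.
  rewrite big1_fset// => g; rewrite !inE => /andP[gB /eqP ga].
  by rewrite ga (negbTE aB) in gB.
by move=> g; rewrite !inE => /andP[_ /negbTE ->] _; rewrite cabs0 expr0n.
Qed.

Definition delta (a : X) : l2 := mkl2 (delta_subproof a).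

Lemma deltaE a g : delta a g = (g == a)%:R. Proof. by []. Qed.

Lemma trunc_basis A (x : l2) : trunc A x = \sum_(g <- A) x g *: delta g.
Proof.
apply: l2_ext => h.
have -> : (\sum_(g <- A) x g *: delta g) h = \sum_(g <- A) x g * (h == g)%:R.
  by elim/big_rec2: _ => // g u v _ <-.
rewrite /=; case: ifPn => hA.
  rewrite (big_fsetD1 h)//= eqxx mulr1 big1_fset ?addr0// => g.
  by rewrite !inE eq_sym => /andP[/negbTE-> _] _; rewrite mulr0.
rewrite big1_fset// => g gA _; case: eqP => [hg|]; rewrite ?mulr0//.
by rewrite hg gA in hA.
Qed.

Lemma l2inner_basis (x : l2) a : l2inner x (delta a) = x a.
Proof.
have -> : delta a = trunc [fset a]%fset (delta a).
  by apply: l2_ext => g /=; rewrite inE; case: eqP.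
by rewrite l2inner_trunc big_seq_fset1 /= eqxx rmorph1 mulr1.
Qed.

End SquareSummable.

(** * Bounded operators *)

Section OperatorNorms.
Context {R : realType}.
Local Notation C := (Cplx R).
Context {V : lmodType C} {ip : V -> V -> C} {nrm : V -> R}.
Hypothesis ipV : inner_space ip nrm.
Context (T : V -> V) (M : R).
Hypothesis Tl : forall a x, T (a *: x) = a *: T x.
Hypothesis TM : forall x, nrm (T x) <= M * nrm x.
Let unit_image := [set nrm (T x) | x in [set x | nrm x <= 1]].

Lemma unit_image_neq0 : unit_image !=set0.
Proof. by exists (nrm (T 0)), 0 => //=; rewrite (nrm0 ipV). Qed.

Lemma unit_image_ubound : has_ubound unit_image.
Proof.
exists `|M| => _ [y /= y1 <-]; apply: (le_trans (TM y)).
apply: (@le_trans _ _ (`|M| * nrm y)); last by rewrite ler_piMr.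
by rewrite ler_wpM2r ?(nrm_ge0 ipV)// ler_norm.
Qed.

Lemma sup_unit_ge0 : 0 <= sup unit_image.
Proof.
apply: (@le_trans _ _ (nrm (T 0))); first exact: (nrm_ge0 ipV).
apply: (ub_le_sup unit_image_ubound); exists 0 => //=.
by rewrite (nrm0 ipV).
Qed.

Lemma nrm_le_sup x : nrm (T x) <= sup unit_image * nrm x.
Proof.
have [x0|x0] := eqVneq (nrm x) 0; first by have := TM x; rewrite x0 !mulr0.
have xp : 0 < nrm x by rewrite lt_neqAle eq_sym x0 (nrm_ge0 ipV).
have E r : 0 <= r -> cabs (ofR r) = r by move=> r0; rewrite cabs_ofR ger0_norm.
rewrite -ler_pdivrMr//; apply: (ub_le_sup unit_image_ubound).
exists (ofR (nrm x)^-1 *: x) => /=.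
  by rewrite (nrmZ ipV) E ?invr_ge0 ?(ltW xp)// mulVf.
by rewrite Tl (nrmZ ipV) E ?invr_ge0 ?(ltW xp)// mulrC.
Qed.

Lemma sup_le_bound : 0 <= M -> sup unit_image <= M.
Proof.
move=> M0; apply: ge_sup; first exact: unit_image_neq0.
by move=> _ [y /= y1 <-]; apply: (le_trans (TM y)); rewrite ler_piMr.
Qed.
End OperatorNorms.

Section BoundedOperators.
Context {R : realType} {X : choiceType}.
Local Notation C := (Cplx R).
Local Notation l2 := (l2 R X).
Local Notation bop := (bop R X).

Definition bounded_by (T : l2 -> l2) (M : R) := forall x, l2norm (T x) <= M * l2norm x.

Lemma bop_linear (T : bop) a x y : T (a *: x + y) = a *: T x + T y.
Proof. have [Tl _] := (iffLR (bounded_linearP _) (bopvalP T)). exact: Tl. Qed.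
Lemma bop0 (T : bop) : T 0 = 0.
Proof. by have := bop_linear T (-1) 0 0; rewrite scaler0 addr0 scaleN1r addNr. Qed.
Lemma bopZ (T : bop) a x : T (a *: x) = a *: T x.
Proof. by rewrite -[a *: x]addr0 bop_linear bop0 addr0. Qed.
Lemma bopD (T : bop) x y : T (x + y) = T x + T y.
Proof. by rewrite -{1}[x]scale1r bop_linear scale1r. Qed.
Lemma bopN (T : bop) x : T (- x) = - T x.
Proof. by rewrite -scaleN1r bopZ scaleN1r. Qed.
Lemma bopB (T : bop) x y : T (x - y) = T x - T y.
Proof. by rewrite bopD bopN. Qed.
Lemma bop_sum I (r : seq I) (P : pred I) (F : I -> l2) (T : bop) :
  T (\sum_(i <- r | P i) F i) = \sum_(i <- r | P i) T (F i).
Proof. by apply: big_morph => [x y|]; [exact: bopD|exact: bop0]. Qed.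

Lemma bop_bound (T : bop) : exists2 M : R, 0 <= M & bounded_by T M.
Proof.
have [_ [M TM]] : linear T /\ exists M, bounded_by T M by apply: asboolW (bopvalP T).
exists `|M| => // x; apply: (le_trans (TM x)).
by rewrite ler_wpM2r ?l2norm_ge0// ler_norm.
Qed.

Lemma mkbop_subproof (T : l2 -> l2) (M : R) :
  (forall a x y, T (a *: x + y) = a *: T x + T y) -> bounded_by T M ->
  T \in bounded_linear.
Proof. by move=> Tl TM; apply: (introT (asboolP _)); split=> //; exists M. Qed.

Definition mkbop T M Tl TM : bop := Bop (@mkbop_subproof T M Tl TM).

Lemma bop_ext (S T : bop) : (forall x, S x = T x) -> S = T.
Proof. by move=> ST; apply: val_inj; apply: funext. Qed.

Lemma bopDE (S T : bop) x : (S + T) x = S x + T x. Proof. by []. Qed.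
Lemma bopZE a (T : bop) x : (a *: T) x = a *: T x. Proof. by []. Qed.
Lemma bopNE (T : bop) x : (- T) x = - T x. Proof. by []. Qed.
Lemma bopBE (S T : bop) x : (S - T) x = S x - T x. Proof. by []. Qed.
Lemma bop0E x : (0 : bop) x = 0. Proof. by []. Qed.
Lemma bop_compE (S T : bop) x : bop_comp S T x = S (T x). Proof. by []. Qed.

Lemma bop1_subproof : bounded_by id 1.
Proof. by move=> x; rewrite mul1r. Qed.
Definition bop1 : bop := mkbop (fun a x y => erefl) bop1_subproof.

Lemma le_opnorm (T : bop) x : l2norm (T x) <= opnorm T * l2norm x.
Proof.
have [M _ TM] := bop_bound T.
exact: (nrm_le_sup l2_inner_space (bopZ T) TM).
Qed.

Lemma opnorm_le (T : bop) (M : R) : 0 <= M -> bounded_by T M -> opnorm T <= M.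
Proof. by move=> M0 TM; exact: (sup_le_bound l2_inner_space TM). Qed.

Lemma opnorm_ge0 (T : bop) : 0 <= opnorm T.
Proof.
have [M _ TM] := bop_bound T.
exact: (sup_unit_ge0 l2_inner_space TM).
Qed.

(** Truncations are finite combinations of the basis vectors, and are dense. *)
Lemma basis_dense (S T : bop) :
  (forall a b, S (delta a) b = T (delta a) b) -> S = T.
Proof.
move=> ST; suff {S T ST} key (D : bop) : (forall a, D (delta a) = 0) -> D = 0.
  apply/eqP; rewrite -subr_eq0; apply/eqP/key => a.
  by rewrite bopBE; apply/eqP; rewrite subr_eq0; apply/eqP/l2_ext.
move=> D0; apply: bop_ext => x; apply: l2norm_eq0; apply/le_anti.
rewrite l2norm_ge0 andbT; apply/ler_addgt0Pr => e e0; rewrite add0r.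
have [M M0 DM] := bop_bound D.
have M1 : 0 < M + 1 by rewrite ltr_wpDl.
have [A Ae] := trunc_approx x (divr_gt0 e0 M1).
have -> : D x = D (x - trunc A x).
  rewrite bopB trunc_basis bop_sum big1 ?subr0// => i _.
  by rewrite bopZ D0 scaler0.
apply: (le_trans (DM _)).
apply: (@le_trans _ _ ((M + 1) * (e / (M + 1)))).
  apply: ler_pM => //; rewrite ?l2norm_ge0 ?lerDl// ltW//.
  exact: Ae.
by rewrite mulrC divfK// gt_eqF.
Qed.

End BoundedOperators.

(** * Pointwise limits of operators, and adjoints *)

Section PointwiseLimits.
Context {R : realType} {X : choiceType}.
Local Notation C := (Cplx R).
Local Notation l2 := (l2 R X).
Local Notation bop := (bop R X).
Context {I : Type} (F : set_system I).

Lemma cvg_psq_seq {FF : ProperFilter F} (u : I -> l2) (v : X -> C) A :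
  (forall g, (fun i => u i g) @ F --> v g) ->
  (fun i => psq (u i) A) @ F --> psq v A.
Proof.
move=> uv; rewrite /psq; elim: (enum_fset A) => [|a s IH].
  rewrite big_nil (_ : (fun _ => _) = fun=> 0); first exact: cvg_cst.
  by apply/funext => i; rewrite big_nil.
rewrite big_cons (_ : (fun _ => _) =
    fun i => cabs (u i a) ^+ 2 + \sum_(g <- s) cabs (u i g) ^+ 2).
  by apply: cvgD => //; apply: cvgM; apply: cvg_cabs; exact: uv.
by apply/funext => i; rewrite big_cons.
Qed.

Lemma fatou_psq {FF : ProperFilter F} (u : I -> l2) (v : X -> C) (M : R) :
  (forall g, (fun i => u i g) @ F --> v g) ->
  (\forall i \near F, l2norm (u i) <= M) -> forall A, psq v A <= M ^+ 2.
Proof.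
move=> uv uM A; have uvA := @cvg_psq_seq FF u v A uv.
apply: cvgr_to_le uvA _.
apply: filterS uM => i iM; apply: (le_trans (psq_le_l2norm _ _)).
by rewrite ler_sqr ?nnegrE ?l2norm_ge0// (le_trans (l2norm_ge0 _) iM).
Qed.

(** Fatou's lemma: norms are suprema of finite sums, which pass to the limit. *)
Lemma l2norm_fatou {FF : ProperFilter F} (u : I -> l2) (v : l2) (M : R) :
  (forall g, (fun i => u i g) @ F --> v g) ->
  (\forall i \near F, l2norm (u i) <= M) -> l2norm v <= M.
Proof.
move=> uv uM; apply: l2norm_le; last exact: fatou_psq uv uM.
by have [i iM] := filter_ex uM; exact: le_trans (l2norm_ge0 _) iM.
Qed.

Lemma cvg_l2inner_weak {FF : ProperFilter F} (u : I -> l2) (v y : l2) (M : R) :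
  (forall g, (fun i => u i g) @ F --> v g) ->
  (forall i, l2norm (u i) <= M) ->
  (fun i => l2inner (u i) y) @ F --> l2inner v y.
Proof.
move=> uv uM; apply/cvgCP => e e0.
have M0 : 0 <= M.
  by have [i _] := filter_ex (@filterT _ F _); exact: le_trans (l2norm_ge0 _) (uM i).
have vM : l2norm v <= M by apply: (l2norm_fatou uv); exact: filterE.
pose d := e / (3 * (M + 1)); have d0 : 0 < d by rewrite divr_gt0// mulr_gt0// ltr_wpDl.
have dM : d * M <= e / 3.
  rewrite /d invfM mulrA -mulrA ler_piMr ?divr_ge0 ?(ltW e0)//.
  by rewrite mulrC ler_pdivrMr ?ltr_wpDl// mul1r lerDl.
have [A Ae] := l2inner_approx y d0.
have S w : l2norm w <= M -> cabs (l2inner w y - \sum_(g <- A) w g * (y g)^*) <= e / 3.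
  by move=> wM; apply: (le_trans (Ae w)); apply: le_trans dM; rewrite ler_wpM2l// ltW.
have : (fun i => \sum_(g <- A) u i g * (y g)^*) @ F --> (\sum_(g <- A) v g * (y g)^* : C).
  apply: cvgC_sum => g.
  by apply: (@cvgC_mul R I F FF (fun i => u i g) (fun=> (y g)^*) _ _ (uv g)); exact: cvgC_cst.
have e3 : 0 < e / 3 by rewrite divr_gt0.
move=> /cvgCP/(_ _ e3); apply: filterS => i H.
set a := \sum_(g <- A) u i g * _ in H; set b := \sum_(g <- A) v g * _ in H.
have -> : l2inner (u i) y - l2inner v y =
  (l2inner (u i) y - a) + (a - b) + (b - l2inner v y) by ring.
apply: (le_lt_trans (le_cabsD _ _)).
have := le_cabsD (l2inner (u i) y - a) (a - b).
have := S _ (uM i); have := S _ vM; rewrite cabsBC -/a -/b => h1 h2 h3.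
lra.
Qed.

Context {FU : UltraFilter F} (S : I -> bop) (M : R).
Hypothesis SM : forall i, bounded_by (S i) M.

Let wlim_cvg x g : (fun i => S i x g) @ F --> (lim ((fun i => S i x g) @ F) : C).
Proof.
apply: (@ultra_bounded_cvg R I F FU _ (M * l2norm x)) => i.
by apply: (le_trans (cabs_le_l2norm _ _)); exact: SM.
Qed.

Let wlim_psq x A : psq (fun g => lim ((fun i => S i x g) @ F) : C) A <= (M * l2norm x) ^+ 2.
Proof.
apply: (fatou_psq (u := fun i => S i x)) => [g|]; first exact: wlim_cvg.
by apply: filterE => i; exact: SM.
Qed.

Let wlim_vec x : l2 := mkl2 (wlim_psq x).

Let wlim_linear a x y : wlim_vec (a *: x + y) = a *: wlim_vec x + wlim_vec y.
Proof.
apply: l2_ext => g; rewrite l2D l2Z /=; apply: cvgC_lim.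
rewrite (_ : (fun i => _) = fun i => a * S i x g + S i y g).
  by apply: cvgD; [apply: cvgMr|]; exact: wlim_cvg.
by apply/funext => i; rewrite bop_linear.
Qed.

Let wlim_bound : bounded_by wlim_vec M.
Proof.
move=> x; apply: (l2norm_fatou (u := fun i => S i x)) => [g|]; first exact: wlim_cvg.
by apply: filterE => i; exact: SM.
Qed.

(** Uniformly bounded operators converge along an ultrafilter in the weak
    operator topology, by compactness of the matrix coefficients. This single
    construction gives both the limits of translates and the completeness of
    the algebra of operators. *)
Definition wlim : bop := mkbop wlim_linear wlim_bound.

Lemma cvg_wlim x g : (fun i => S i x g) @ F --> (wlim x g : C).
Proof. exact: wlim_cvg. Qed.

Lemma cvg_wlim_inner x y : (fun i => l2inner (S i x) y) @ F --> l2inner (wlim x) y.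
Proof.
by apply: cvg_l2inner_weak => [g|i]; [exact: cvg_wlim|exact: SM].
Qed.

End PointwiseLimits.

Section Adjoints.
Context {R : realType} {X : choiceType}.
Local Notation C := (Cplx R).
Local Notation l2 := (l2 R X).
Local Notation bop := (bop R X).
Local Notation IP := (@l2_inner_space R X).

Lemma cvg_trunc_op (T : bop) (x y : l2) :
  (fun A : {fset X} => l2inner (T (trunc A x)) y) @ totally --> l2inner (T x) y.
Proof.
apply/cvgCP => e e0; have [M M0 TM] := bop_bound T.
pose K := M * l2norm y + 1; have K0 : 0 < K by rewrite ltr_wpDl ?mulr_ge0 ?l2norm_ge0.
have [A Ae] := trunc_approx x (divr_gt0 e0 K0); exists A => // B /= /Ae AB.
rewrite cabsBC -(ipBl IP) -bopB; apply: (le_lt_trans (le_ip_nrm IP _ _)).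
have h1 : l2norm (T (x - trunc B x)) * l2norm y <= l2norm (x - trunc B x) * (M * l2norm y).
  by rewrite mulrCA mulrA ler_wpM2r ?l2norm_ge0.
apply: (le_lt_trans h1); apply: (@le_lt_trans _ _ (l2norm (x - trunc B x) * K)).
  by rewrite ler_wpM2l ?l2norm_ge0// lerDl.
by rewrite -ltr_pdivlMr.
Qed.

Section Construction.
Variable T : bop.
Let coef y g : C := (l2inner (T (delta g)) y)^*.

(** The norm of the coefficient vector is found by testing [y] against the image
    of that very vector, truncated to a finite set. *)
Let coef_psq M y A : 0 <= M -> bounded_by T M -> psq (coef y) A <= (M * l2norm y) ^+ 2.
Proof.
move=> M0 TM; set s := psq _ A.
pose c g : C := if g \in A then coef y g else 0.
have cs B : psq c B <= s.
  apply: (le_trans (le_psq _ (fsubsetUr A B))).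
  rewrite /psq (big_fsetD _ (fsubsetUl A B)) [X in _ + X]big1_fset ?addr0.
    rewrite le_eqVlt; apply/orP; left; apply/eqP.
    by apply: eq_fbigr => g gA _; rewrite /c gA.
  by move=> g; rewrite !inE /c => /andP[/negbTE -> _] _; rewrite cabs0 expr0n.
pose x := mkl2 cs; have xs : l2norm x ^+ 2 <= s by exact: l2norm_sqr_le.
have xA : x = trunc A x by apply: l2_ext => g /=; rewrite /c; case: ifP.
have E : l2inner (T x) y = ofR s.
  rewrite xA trunc_basis bop_sum (ip_suml IP) /s /psq ofR_sum.
  apply: eq_fbigr => g gA _; rewrite bopZ (ipZl IP) -mulCJ.
  by rewrite [x g]/= /c gA /coef conjCK.
have s0 : 0 <= s by exact: psq_ge0.
have h : s <= M * l2norm x * l2norm y.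
  have := le_ip_nrm IP (T x) y; rewrite E cabs_ofR ger0_norm// => h.
  by apply: (le_trans h); rewrite ler_wpM2r ?l2norm_ge0.
have h2 : s ^+ 2 <= (M * l2norm y) ^+ 2 * s.
  apply: (@le_trans _ _ ((M * l2norm x * l2norm y) ^+ 2)).
    by rewrite ler_sqr ?nnegrE ?mulr_ge0 ?l2norm_ge0.
  by rewrite mulrAC exprMn ler_wpM2l ?sqr_ge0.
have [->|sn0] := eqVneq s 0; first exact: sqr_ge0.
by move: h2; rewrite expr2 ler_pM2r// lt_neqAle eq_sym sn0.
Qed.

Lemma adjoint_exists : exists S, is_adjoint T S.
Proof.
have [M M0 TM] := bop_bound T.
pose S y : l2 := mkl2 (fun A => @coef_psq M y A M0 TM).
have Sl a x y : S (a *: x + y) = a *: S x + S y.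
  apply: l2_ext => g; rewrite l2D l2Z /= /coef (ipr IP).
  by rewrite rmorphD rmorphM/= conjCK.
have SM : bounded_by S M.
  move=> y; apply: l2norm_le => [|A]; last exact: coef_psq.
  by rewrite mulr_ge0 ?l2norm_ge0.
exists (mkbop Sl SM) => x y.
apply: (cvgC_unique (F := totally)); first exact: cvg_trunc_op.
rewrite (_ : (fun A => _) = fun A : {fset X} => \sum_(g <- A) x g * (S y g)^*).
  exact: cvg_l2inner.
apply/funext => A; rewrite trunc_basis bop_sum (ip_suml IP).
by apply: eq_bigr => g _; rewrite bopZ (ipZl IP) /= /coef conjCK.
Qed.
End Construction.

Lemma adjoint_sym (T S : bop) : is_adjoint T S -> is_adjoint S T.
Proof. by move=> TS x y; rewrite (ipJ IP) -TS -(ipJ IP). Qed.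

Lemma adjoint_unique (T S S' : bop) : is_adjoint T S -> is_adjoint T S' -> S = S'.
Proof.
move=> /adjoint_sym TS /adjoint_sym TS'; apply: bop_ext => y; apply: l2_ext => g.
by rewrite -!l2inner_basis TS TS'.
Qed.

Lemma adjoint_bound (T S : bop) M : is_adjoint T S -> bounded_by T M -> bounded_by S M.
Proof.
move=> TS TM y; have [->|Sy0] := eqVneq (l2norm (S y)) 0.
  have := TM y; have := l2norm_ge0 (T y) => h1 h2; exact: le_trans h1 h2.
have Sp : 0 < l2norm (S y) by rewrite lt_neqAle eq_sym Sy0 l2norm_ge0.
rewrite -(ler_pM2r Sp) -expr2.
have := le_ip_nrm IP (T (S y)) y; rewrite TS (ipxx IP) cabs_ofR ger0_norm ?sqr_ge0// => h.
apply: (le_trans h); rewrite [leRHS]mulrAC ler_wpM2r ?l2norm_ge0//.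
Qed.

Lemma adjoint_lin a (S T S' T' : bop) : is_adjoint S S' -> is_adjoint T T' ->
  is_adjoint (a *: S + T) (a^* *: S' + T').
Proof.
move=> SS TT x y; rewrite !bopDE !bopZE (ipl IP) (ipr IP) conjCK.
by rewrite SS TT.
Qed.

Lemma adjoint_comp (S T S' T' : bop) : is_adjoint S S' -> is_adjoint T T' ->
  is_adjoint (bop_comp S T) (bop_comp T' S').
Proof. by move=> SS TT x y; rewrite !bop_compE SS TT. Qed.

End Adjoints.

(** * Ultrafilter limits of right translates *)

Section Isometries.
Context {R : realType}.
Local Notation C := (Cplx R).
Context {V : lmodType C} {ip : V -> V -> C} {nrm : V -> R}.
Hypothesis ipV : inner_space ip nrm.

(** The real part of the inner product is a combination of norms, and its
    imaginary part is the real part at [i x]. *)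
Lemma isometry_ip (T : V -> V) : (forall a x y, T (a *: x + y) = a *: T x + T y) ->
  (forall x, nrm (T x) = nrm x) -> forall x y, ip (T x) (T y) = ip x y.
Proof.
move=> Tl Tn.
have T0 : T 0 = 0 by have := Tl (-1) 0 0; rewrite scaler0 addr0 scaleN1r addNr.
have TD x y : T (x + y) = T x + T y by have := Tl 1 x y; rewrite !scale1r.
have TZ a x : T (a *: x) = a *: T x by have := Tl a x 0; rewrite T0 !addr0.
have re x y : reC (ip (T x) (T y)) = reC (ip x y).
  have := nrmD_sqr ipV (T x) (T y); rewrite -TD !Tn (nrmD_sqr ipV x y); lra.
move=> x y; have h1 := re x y; have h2 := re ((0 +i* 1)%C *: x) y.
move: h1 h2; rewrite TZ !(ipZl ipV).
case: (ip (T x) (T y)) => a b; case: (ip x y) => c d /= h1 h2.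
by apply/eqP; rewrite eq_complex/=; apply/andP; split; apply/eqP; lra.
Qed.
End Isometries.

Section RightTranslations.
Context {R : realType} {G : groupType}.
Local Notation C := (Cplx R).
Local Notation l2 := (l2 R G).
Local Notation bop := (bop R G).
Local Notation IP := (@l2_inner_space R G).

Implicit Types (S T : bop) (x y : l2).

Lemma nsq_transr (h : G) (f : G -> C) : nsq (fun k => f (k * h^-1)%g) = nsq f.
Proof.
rewrite /nsq [RHS](@reindex_esum R G G setT setT (fun k => k * h^-1)%g)//.
split=> // [x y _ _ /mulIg//|y _]; exists (y * h)%g => //.
by rewrite mulgK.
Qed.

Lemma rreg_sqsummable (h : G) (x : l2) : (fun k => x (k * h^-1)%g) \in sqsummable.
Proof. by rewrite inE nsq_transr; exact: l2valP. Qed.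

Lemma rreg_norm (h : G) (x : l2) : l2norm (L2 (rreg_sqsummable h x)) = l2norm x.
Proof. by rewrite /l2norm /= nsq_transr. Qed.

Lemma rreg_bounded (h : G) : bounded_by (fun x : l2 => L2 (rreg_sqsummable h x)) 1.
Proof. by move=> x; rewrite rreg_norm mul1r. Qed.

Lemma rreg_linear (h : G) a (x y : l2) : L2 (rreg_sqsummable h (a *: x + y)) =
  a *: L2 (rreg_sqsummable h x) + L2 (rreg_sqsummable h y).
Proof. exact: l2_ext. Qed.

(** The right regular representation, which commutes with the left one. *)
Definition rreg (h : G) : bop := mkbop (rreg_linear h) (rreg_bounded h).

Lemma rregE h x k : rreg h x k = x (k * h^-1)%g. Proof. by []. Qed.
Lemma l2norm_rreg h x : l2norm (rreg h x) = l2norm x.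
Proof. exact: rreg_norm. Qed.
Lemma rreg_rreg g h x : rreg g (rreg h x) = rreg (h * g)%g x.
Proof. by apply: l2_ext => k; rewrite !rregE invgM mulgA. Qed.
Lemma rregVK h x : rreg h (rreg h^-1 x) = x.
Proof. by apply: l2_ext => k; rewrite !rregE invgK mulgVK. Qed.
Lemma rreg_inner h x y : l2inner (rreg h x) (rreg h y) = l2inner x y.
Proof. by apply: (isometry_ip IP) => *; [exact: bop_linear|exact: l2norm_rreg]. Qed.
Lemma rreg_adjoint h x y : l2inner (rreg h^-1 x) y = l2inner x (rreg h y).
Proof. by rewrite -(rreg_inner h) rregVK. Qed.

Definition rconj (T : bop) (h : G) : bop := bop_comp (rreg h^-1) (bop_comp T (rreg h)).

Lemma rconjE T h x b : rconj T h x b = T (rreg h x) (b * h)%g.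
Proof. by rewrite /rconj !bop_compE rregE invgK. Qed.

Lemma rconj_inner T h x y : l2inner (rconj T h x) y = l2inner (T (rreg h x)) (rreg h y).
Proof. by rewrite /rconj !bop_compE rreg_adjoint. Qed.

Lemma rconj_bound (T : bop) h M : bounded_by T M -> bounded_by (rconj T h) M.
Proof.
by move=> TM x; rewrite /rconj !bop_compE l2norm_rreg (le_trans (TM _))// l2norm_rreg.
Qed.

(** The map [Phi_mu] of the introduction. *)
Definition tlim (mu : beta G) (T : bop) : bop :=
  @wlim R G G (ufilter mu) (ufilterP mu) (rconj T) (opnorm T)
    (fun h => rconj_bound h (le_opnorm T)).

Section Fixed.
Variable mu : beta G.
Let F := ufilter mu.
#[local] Instance tlimFU : UltraFilter F := ufilterP mu.
Let FF : Filter F := _.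
Let FP : ProperFilter F := _.

Lemma cvg_tlim T x b : (fun h => T (rreg h x) (b * h)%g) @ F --> (tlim mu T x b : C).
Proof.
rewrite (_ : (fun h => _) = fun h => rconj T h x b); first exact: cvg_wlim.
by apply/funext => h; rewrite rconjE.
Qed.

(** [R_h] is unitary with inverse [R_(h^-1)], so conjugation by it moves to both
    arguments of the inner product. This form makes adjoints and positivity
    pass to the limit. *)
Lemma cvg_tlim_inner T x y :
  (fun h => l2inner (T (rreg h x)) (rreg h y)) @ F --> l2inner (tlim mu T x) y.
Proof.
rewrite (_ : (fun h => _) = fun h => l2inner (rconj T h x) y); first exact: cvg_wlim_inner.
by apply/funext => h; rewrite rconj_inner.
Qed.

Lemma tlimP (T : bop) x (v : l2) :
  (forall b, (fun h => T (rreg h x) (b * h)%g) @ F --> (v b : C)) -> tlim mu T x = v.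
Proof.
move=> H; apply: l2_ext => b.
exact: (@cvgC_unique R G F _ _ _ _ (@cvg_tlim T x b) (H b)).
Qed.

Lemma tlim_lin a S T : tlim mu (a *: S + T) = a *: tlim mu S + tlim mu T.
Proof.
apply: bop_ext => x; apply: tlimP => b.
have -> : (a *: tlim mu S + tlim mu T) x b = a * tlim mu S x b + tlim mu T x b by [].
rewrite (_ : (fun h => _) = fun h =>
  a * S (rreg h x) (b * h)%g + T (rreg h x) (b * h)%g)//.
have hS := @cvgC_mull R G F FF a _ _ (@cvg_tlim S x b).
exact: (@cvgC_add R G F FF _ _ _ _ hS (@cvg_tlim T x b)).
Qed.

Lemma tlim0 : tlim mu 0 = 0.
Proof. by have := tlim_lin (-1) 0 0; rewrite scaler0 addr0 scaleN1r addNr. Qed.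

Lemma tlimD S T : tlim mu (S + T) = tlim mu S + tlim mu T.
Proof. by rewrite -{1}[S]scale1r tlim_lin scale1r. Qed.

Lemma tlimB S T : tlim mu (S - T) = tlim mu S - tlim mu T.
Proof. by rewrite addrC -scaleN1r tlim_lin scaleN1r addrC. Qed.

Lemma tlim_sum I (r : seq I) (P : pred I) (f : I -> bop) :
  tlim mu (\sum_(i <- r | P i) f i) = \sum_(i <- r | P i) tlim mu (f i).
Proof. by apply: big_morph => [x y|]; [exact: tlimD|exact: tlim0]. Qed.

Lemma tlim_bound (T : bop) M : bounded_by T M -> bounded_by (tlim mu T) M.
Proof.
move=> TM x;
apply: (@l2norm_fatou R G G F FP (fun h => rconj T h x)
  (tlim mu T x) (M * l2norm x)) => [g|].
  exact: cvg_wlim.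
by apply: filterE => h; exact: rconj_bound.
Qed.

Lemma tlim_adjoint S T : is_adjoint S T -> is_adjoint (tlim mu S) (tlim mu T).
Proof.
move=> ST x y; apply: (@cvgC_unique R G F _ _ _ _ (@cvg_tlim_inner S x y)).
rewrite (_ : (fun h => _) = fun h => (l2inner (T (rreg h y)) (rreg h x))^*).
  by rewrite (ipJ IP); apply: cvg_conj; exact: cvg_tlim_inner.
by apply/funext => h; rewrite ST (ipJ IP).
Qed.

(** The numbers [f (b h)] converge along [mu], and multiply the matrix
    coefficients of [T]; weak convergence is enough as only the left factor of
    the composite has to be diagonal. *)
Lemma tlim_mulop (f : linf) T :
  tlim mu (bop_comp (mulop f) T) = bop_comp (mulop (pi_fun mu f)) (tlim mu T).
Proof.
apply: bop_ext => x; apply: tlimP => b; rewrite bop_compE.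
have [M fM] := @linfP _ _ f.
have hf : (fun h => f (b * h)%g) @ F --> (pi_fun mu f b : C).
  exact: (@ultra_bounded_cvg R G F _ (fun h => f (b * h)%g) M).
exact: (@cvgC_mul R G F FF _ _ _ _ hf (@cvg_tlim T x b)).
Qed.

Lemma tlim_lreg g T : tlim mu (bop_comp (lreg g) T) = bop_comp (lreg g) (tlim mu T).
Proof.
apply: bop_ext => x; apply: tlimP => b; rewrite bop_compE.
rewrite (_ : (fun h => _) = fun h => T (rreg h x) (g^-1 * b * h)%g); first exact: cvg_tlim.
by apply/funext => h; rewrite bop_compE /= mulgA.
Qed.

Lemma tlim1 : tlim mu (bop1 : bop) = bop1.
Proof.
apply: bop_ext => x; apply: tlimP => b.
rewrite (_ : (fun h => _) = fun=> x b); first exact: cvg_cst.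
by apply/funext => h /=; rewrite mulgK.
Qed.

Lemma tlim_cp : completely_positive (tlim mu).
Proof.
split=> [a S T|n T Tpos x]; first exact: tlim_lin.
have cv : (fun h => \sum_i l2inner (mx_app T (fun j => rreg h (x j)) i) (rreg h (x i))) @ F
    --> (\sum_i l2inner (mx_app (map_mx (tlim mu) T) x i) (x i) : C).
  rewrite (_ : (fun h => _) = fun h =>
     \sum_i \sum_j l2inner (T i j (rreg h (x j))) (rreg h (x i))).
    rewrite (_ : (\sum_i _) = \sum_i \sum_j l2inner (tlim mu (T i j) (x j)) (x i)).
      by apply: cvgC_sum => i; apply: cvgC_sum => j; exact: cvg_tlim_inner.
    apply: eq_bigr => i _; rewrite /mx_app (ip_suml IP).
    by apply: eq_bigr => j _; rewrite mxE.
  by apply/funext => h; apply: eq_bigr => i _; rewrite /mx_app (ip_suml IP).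
by apply: ge0_cvgC cv => h; exact: Tpos.
Qed.
End Fixed.
End RightTranslations.

(** * Neumann series and automatic continuity *)

Section Neumann.
Context {R : realType} {X : choiceType}.
Local Notation C := (Cplx R).
Local Notation l2 := (l2 R X).
Local Notation bop := (bop R X).
Local Notation IP := (@l2_inner_space R X).
Implicit Types (S T : bop) (x y : l2).

Lemma bounded_comp S T M N : 0 <= M -> bounded_by S M -> bounded_by T N ->
  bounded_by (bop_comp S T) (M * N).
Proof.
move=> M0 SM TN x; rewrite bop_compE; apply: (le_trans (SM _)).
by rewrite -mulrA ler_wpM2l.
Qed.

Section Series.
Context (b : bop) (r : R).
Hypothesis (r0 : 0 <= r) (r1 : r < 1) (br : bounded_by b r).

Fixpoint bpow n : bop := if n is m.+1 then bop_comp (bpow m) b else bop1.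
Fixpoint bgeom n : bop := if n is m.+1 then bgeom m + bpow m else 0.

Lemma bpow_bound n : bounded_by (bpow n) (r ^+ n).
Proof.
elim: n => [|n IH] x; first by rewrite /= expr0 mul1r.
by rewrite exprSr; apply: bounded_comp => //; exact: exprn_ge0.
Qed.

Lemma bgeom_telescope n x : bgeom n (x - b x) = x - bpow n x.
Proof.
elim: n => [|n IH]; first by rewrite /= subrr.
have -> : bgeom n.+1 (x - b x) = bgeom n (x - b x) + bpow n (x - b x) by [].
have -> : bpow n.+1 x = bpow n (b x) by [].
by rewrite IH bopB addrA subrK.
Qed.

Lemma bgeom_dist n k x :
  l2norm (bgeom (n + k) x - bgeom n x) <= (r ^+ n - r ^+ (n + k)) / (1 - r) * l2norm x.
Proof.
elim: k => [|k IH]; first by rewrite addn0 !subrr (nrm0 IP) !mul0r.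
rewrite addnS [bgeom _ x]bopDE addrAC; apply: (le_trans (le_nrmD IP _ _)).
apply: (le_trans (lerD IH (bpow_bound _ _))); rewrite -mulrDl ler_wpM2r ?l2norm_ge0//.
rewrite le_eqVlt exprS; apply/orP; left; apply/eqP; field.
by rewrite subr_eq0 eq_sym lt_eqF.
Qed.

Lemma geometric_small (K e : R) : 0 < e -> exists n, r ^+ n * K < e.
Proof.
move=> e0; have K1 : 0 < `|K| + 1 by rewrite ltr_wpDl.
have : (fun n => r ^+ n) @ \oo --> (0 : R) by apply: cvg_expr; rewrite ger0_norm.
move=> /cvgrPdist_lt/(_ _ (divr_gt0 e0 K1))[n _ /(_ n (leqnn n))].
rewrite /= sub0r normrN ger0_norm ?exprn_ge0// ltr_pdivlMr// => h; exists n.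
apply: le_lt_trans h; rewrite ler_wpM2l ?exprn_ge0//.
by apply: (le_trans (ler_norm _)); rewrite lerDl.
Qed.

(** The inverse is first built as a weak limit of the partial sums; the geometric
    bound then shows that the convergence holds in norm, hence inside [A]. *)
Lemma neumann (A : set bop) : cstar_subalgebra A -> A bop1 -> A b ->
  exists2 c, A c & bop_comp c (bop1 - b) = bop1.
Proof.
move=> [[A0 Alin] Amul _ Acl] A1 Ab.
have AS S T : A S -> A T -> A (S + T) by move=> AS AT; rewrite -[S]scale1r; exact: Alin.
have Apow n : A (bpow n) by elim: n => //= n IH; exact: Amul.
have Ageom n : A (bgeom n) by elim: n => //= n IH; exact: AS.
have r1' : 0 < 1 - r by rewrite subr_gt0.
have gb n k x : l2norm (bgeom (n + k) x - bgeom n x) <= r ^+ n / (1 - r) * l2norm x.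
  apply: (le_trans (bgeom_dist n k x)); rewrite ler_wpM2r ?l2norm_ge0//.
  by rewrite ler_wpM2r ?invr_ge0 ?(ltW r1')// gerBl exprn_ge0.
have [F [FU Foo]] := @ultraFilterLemma nat \oo _.
pose FF : Filter F := @ultra_proper _ _ FU.
have gM n : bounded_by (bgeom n) (1 - r)^-1.
  by move=> x; have := gb 0%N n x; rewrite add0n expr0 mul1r bop0E subr0.
pose c := @wlim R X nat F FU bgeom _ gM.
have cb n : bounded_by (c - bgeom n) (r ^+ n / (1 - r)).
  move=> x; rewrite bopBE.
  apply: (@l2norm_fatou R X nat F (@ultra_proper _ _ FU)
            (fun m => bgeom m x - bgeom n x)) => [g|].
    have h := @cvg_wlim R X nat F FU bgeom _ gM x g.
    exact: (@cvgC_add R nat F FF _ _ _ _ h (@cvgC_cst R nat F FF (- bgeom n x g))).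
  apply: Foo; exists n => // m /= nm.
  by rewrite -(subnKC nm).
exists c.
  apply: Acl => e e0; have [n ne] := geometric_small (1 - r)^-1 e0.
  exists (bgeom n) => //; apply: le_lt_trans ne.
  by apply: opnorm_le (cb n); rewrite divr_ge0 ?exprn_ge0// ltW.
apply: bop_ext => x; rewrite bop_compE bopBE /=.
apply/eqP; rewrite -subr_eq0; apply/eqP/l2norm_eq0/le_anti.
rewrite l2norm_ge0 andbT; apply/ler_addgt0Pr => e e0; rewrite add0r.
have [n ne] := geometric_small ((1 - r)^-1 * l2norm (x - b x) + l2norm x) e0.
apply: ltW; apply: le_lt_trans ne.
have -> : c (x - b x) - x = (c - bgeom n) (x - b x) - bpow n x.
  by rewrite bopBE bgeom_telescope -[RHS]addrA -opprD subrK.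
apply: (le_trans (le_nrmD IP _ _)); rewrite (nrmN IP) mulrDr mulrA.
by apply: lerD; [exact: cb|exact: bpow_bound].
Qed.
End Series.

(** Put [N = |pi a|] and suppose [N > 1]. Then [1 - N^-2 a' a] is invertible in
    [A], so [1 - N^-2 pi(a' a)] is bounded below. But this operator nearly
    vanishes on the vectors where [pi a] nearly attains its norm. *)
Lemma star_homomorphism_lt1 (A : set bop) (pi : bop -> bop) (a : bop) (r : R) :
  cstar_subalgebra A -> A bop1 -> star_homomorphism_on A pi -> pi bop1 = bop1 ->
  A a -> 0 <= r -> r < 1 -> bounded_by a r -> bounded_by (pi a) 1.
Proof.
move=> Acs A1 [pil pim pia] pi1 Aa r0 r1 ar.
have [[A0 Alin] Amul Aadj Acl] := Acs.
have [a' aa'] := adjoint_exists a; have Aa' := Aadj _ _ aa' Aa.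
set N := opnorm (pi a).
suff N1 : N <= 1.
  by move=> x; apply: (le_trans (le_opnorm _ _)); rewrite ler_wpM2r ?l2norm_ge0.
rewrite leNgt; apply/negP => N1.
have N0 : 0 < N by apply: lt_trans N1.
pose z : C := ofR (N ^- 2).
have zn : cabs z = N ^- 2 by rewrite cabs_ofR ger0_norm// invr_ge0 sqr_ge0.
have z1 : N ^- 2 <= 1 by rewrite invf_le1 ?exprn_gt0// exprn_ege1// ltW.
pose b := z *: bop_comp a' a.
have Ab : A b by rewrite /b -[_ *: _]addr0; apply: Alin => //; exact: Amul.
have br : bounded_by b r.
  move=> x; rewrite /b bopZE (nrmZ IP) zn.
  apply: (@le_trans _ _ (1 * (r * r * l2norm x))).
    apply: ler_pM => //; rewrite ?l2norm_ge0 ?invr_ge0 ?sqr_ge0//.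
    exact: (bounded_comp r0 (adjoint_bound aa' ar) ar).
  by rewrite mul1r ler_wpM2r ?l2norm_ge0// ler_piMr// ltW.
have [c Ac cb] := neumann r0 r1 br Acs A1 Ab.
have A1b : A (bop1 - b) by rewrite addrC -scaleN1r; exact: Alin.
have pi0 : pi 0 = 0 by have := pil (-1) 0 0 A0 A0; rewrite scaler0 addr0 scaleN1r addNr.
have pib : pi b = z *: bop_comp (pi a') (pi a).
  have Aa'a : A (bop_comp a' a) by exact: Amul.
  by have := pil z _ _ Aa'a A0; rewrite pi0 !addr0 pim.
have E x : pi c (x - pi b x) = x.
  have := congr1 (fun T : bop => T x) (congr1 pi cb).
  rewrite /= pim// pi1 bop_compE.
  have -> : pi (bop1 - b) = - pi b + bop1.
    by rewrite addrC -scaleN1r pil// pi1 scaleN1r.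
  by rewrite bopDE bopNE addrC.
have [K K0 cK] := bop_bound (pi c).
pose L := K + 1; have L0 : 0 < L by rewrite ltr_wpDl.
have cL x : l2norm (pi c x) <= L * l2norm x.
  by apply: (le_trans (cK x)); rewrite ler_wpM2r ?l2norm_ge0// lerDl.
have paa := pia _ _ Aa aa'.
(* uses |pi(a' a) x| <= N |pi(a) x| for the quadratic term *)
have D x : l2norm (x - pi b x) ^+ 2 <= l2norm x ^+ 2 - N ^- 2 * l2norm (pi a x) ^+ 2.
  rewrite (nrmD_sqr IP) (nrmN IP) (ipNr IP) reCN pib bopZE bop_compE (ipZr IP).
  rewrite -paa (ipxx IP) (nrmZ IP) zn /z conj_ofR -ofRM [reC _]/=.
  have h : l2norm (pi a' (pi a x)) <= N * l2norm (pi a x).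
    exact: (adjoint_bound paa (le_opnorm (pi a))).
  have : (N ^- 2 * l2norm (pi a' (pi a x))) ^+ 2 <= N ^- 2 * l2norm (pi a x) ^+ 2.
    rewrite exprMn expr2 -mulrA ler_wpM2l ?invr_ge0 ?sqr_ge0//.
    rewrite -ler_pdivlMl ?invr_gt0 ?exprn_gt0// invrK -exprMn.
    by rewrite ler_sqr ?nnegrE ?mulr_ge0 ?l2norm_ge0 ?(ltW N0).
  lra.
pose q := 1 - L ^- 2.
have aq x : l2norm (pi a x) ^+ 2 <= N ^+ 2 * q * l2norm x ^+ 2.
  have h1 : l2norm x ^+ 2 <= L ^+ 2 * l2norm (x - pi b x) ^+ 2.
    rewrite -exprMn ler_sqr ?nnegrE ?mulr_ge0 ?l2norm_ge0 ?(ltW L0)//.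
    by rewrite -{1}[x]E.
  have h2 : L ^- 2 * l2norm x ^+ 2 <= l2norm x ^+ 2 - N ^- 2 * l2norm (pi a x) ^+ 2.
    apply: le_trans (D x).
    by rewrite -ler_pdivlMl ?invr_gt0 ?exprn_gt0// invrK.
  rewrite -mulrA -ler_pdivrMl ?exprn_gt0// /q mulrBl mul1r; lra.
have q1 : q < 1 by rewrite /q gtrBl invr_gt0 exprn_gt0.
have q0 : 0 <= q.
  rewrite /q subr_ge0 invf_le1 ?exprn_gt0// exprn_ege1// /L lerDr.
  by [].
have sq : Num.sqrt (N ^+ 2 * q) ^+ 2 = N ^+ 2 * q.
  by apply: sqr_sqrtr; apply: mulr_ge0 => //; exact: sqr_ge0.
have : N <= Num.sqrt (N ^+ 2 * q).
  apply: opnorm_le; first exact: sqrtr_ge0.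
  move=> x; rewrite -(@ler_sqr R) ?nnegrE ?mulr_ge0 ?l2norm_ge0 ?sqrtr_ge0//.
  by rewrite exprMn sq; exact: aq.
rewrite -(@ler_sqr R) ?nnegrE ?sqrtr_ge0 ?(ltW N0)// sq.
by rewrite leNgt gtr_pMr ?exprn_gt0// q1.
Qed.

(** Rescale [a] to have norm slightly below one. *)
Lemma star_homomorphism_contractive (A : set bop) (pi : bop -> bop) (a : bop) :
  cstar_subalgebra A -> A bop1 -> star_homomorphism_on A pi -> pi bop1 = bop1 ->
  A a -> bounded_by (pi a) (opnorm a).
Proof.
move=> Acs A1 pih pi1 Aa x; apply/ler_addgt0Pr => e e0.
have [[A0 Alin] _ _ _] := Acs; have [pil _ _] := pih.
have pi0 : pi 0 = 0.
  by have := pil (-1) 0 0 A0 A0; rewrite scaler0 addr0 scaleN1r addNr.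
have nx : 0 < l2norm x + 1 by rewrite ltr_wpDl ?l2norm_ge0.
pose d := e / (l2norm x + 1); have d0 : 0 < d by rewrite divr_gt0.
pose t := opnorm a + d; have t0 : 0 < t by rewrite ltr_wpDl ?opnorm_ge0.
have zt : cabs (ofR t^-1) = t^-1 by rewrite cabs_ofR ger0_norm// invr_ge0 ltW.
have Aa1 : A (ofR t^-1 *: a) by rewrite -[_ *: _]addr0; exact: Alin.
have a1r : bounded_by (ofR t^-1 *: a) (opnorm a / t).
  move=> y; rewrite bopZE (nrmZ IP) zt (mulrC (opnorm a)) -mulrA.
  apply: ler_wpM2l; first by rewrite invr_ge0 ltW.
  exact: le_opnorm.
have r0 : 0 <= opnorm a / t by rewrite divr_ge0 ?opnorm_ge0 ?(ltW t0).
have r1 : opnorm a / t < 1 by rewrite ltr_pdivrMr// mul1r /t ltrDl.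
have := star_homomorphism_lt1 Acs A1 pih pi1 Aa1 r0 r1 a1r x.
have -> : pi (ofR t^-1 *: a) = ofR t^-1 *: pi a.
  by have := pil (ofR t^-1) _ _ Aa A0; rewrite pi0 !addr0.
rewrite bopZE (nrmZ IP) zt mul1r ler_pdivrMl// => h; apply: (le_trans h).
rewrite /t mulrDl lerD2l /d mulrAC ler_pdivrMr// ler_wpM2l ?(ltW e0)//.
by rewrite lerDl.
Qed.
End Neumann.

(** * The crossed product and its covariant representations *)

Section CrossedProduct.
Context {R : realType} {G : groupType}.
Local Notation C := (Cplx R).
Local Notation l2 := (l2 R G).
Local Notation bop := (bop R G).
Local Notation IP := (@l2_inner_space R G).
Local Notation CP := (@crossed_product R G).
Local Notation linf := (@linf R G).
Implicit Types (S T : bop) (x y : l2).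

Lemma cstar_generated_cstar (B : set bop) : cstar_subalgebra (cstar_generated B).
Proof.
split.
- split=> [A [[[A0 _] _ _ _] _]//|a S T hS hT A hA].
  by have [[[_ Al] _ _ _] _] := hA; apply: Al; [exact: hS|exact: hT].
- move=> S T hS hT A hA; have [[_ Am _ _] _] := hA.
  by apply: Am; [exact: hS|exact: hT].
- move=> S T ST hS A hA; have [[_ _ Aa _] _] := hA.
  by apply: Aa ST _; exact: hS.
- move=> T hT A hA; have [[_ _ _ Ac] _] := hA.
  by apply: Ac => e /hT[S hS Se]; exists S => //; exact: hS.
Qed.

Lemma crossed_cstar : cstar_subalgebra CP.
Proof. exact: cstar_generated_cstar. Qed.

Lemma crossed_mulop (f : linf) : CP (mulop f).
Proof. by move=> A [_]; apply; left; exists f. Qed.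

Lemma crossed_lreg g : CP (lreg g).
Proof. by move=> A [_]; apply; right; exists g. Qed.

Lemma conj_bounded (f : linf) : bounded_function (fun g => (f g)^* : C).
Proof. by have [M fM] := @linfP _ _ f; exists M => g; rewrite cabsJ. Qed.

Lemma mulop_adjoint (f : linf) : is_adjoint (mulop f) (mulop (Linf (conj_bounded f))).
Proof.
move=> x y; rewrite /l2inner; congr (summability.sum _); apply/funext => g /=.
by rewrite rmorphM/= conjCK mulrA (mulrC (f g)).
Qed.

Lemma lreg_inner g x y : l2inner (lreg g x) (lreg g y) = l2inner x y.
Proof.
apply: (isometry_ip IP) => [a u v|u]; first exact: bop_linear.
by rewrite /l2norm /= nsq_transl.
Qed.

Lemma lregM g h x : lreg g (lreg h x) = lreg (g * h)%g x.
Proof. by apply: l2_ext => k /=; rewrite invgM mulgA. Qed.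

Lemma lreg1 : lreg 1%g = bop1 :> bop.
Proof. by apply: bop_ext => x; apply: l2_ext => k /=; rewrite invg1 mul1g. Qed.

Lemma lreg_adjoint g : is_adjoint (lreg g : bop) (lreg g^-1).
Proof. by move=> x y; rewrite -(lreg_inner g x) lregM mulgV lreg1. Qed.

Lemma crossed1 : CP bop1.
Proof. by rewrite -lreg1; exact: crossed_lreg. Qed.

(** Induction over a generated C*-algebra without a case for adjoints: the
    generators are stable under adjunction, so the elements that satisfy [K]
    together with their adjoints already form a C*-algebra. *)
Lemma crossed_ind (K : set bop) :
  (forall a S T, CP S -> CP T -> K S -> K T -> K (a *: S + T)) ->
  (forall S T, CP S -> CP T -> K S -> K T -> K (bop_comp S T)) ->
  (forall T, CP T ->
     (forall e : R, 0 < e -> exists S, [/\ CP S, K S & opnorm (T - S) < e]) -> K T) ->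
  (forall f, K (mulop f)) -> (forall g, K (lreg g)) ->
  forall T, CP T -> K T.
Proof.
move=> Klin Kmul Kcl Kf Kg.
have [[C0 Cl] Cm Ca Cc] := crossed_cstar.
pose A := [set T | [/\ CP T, K T & forall T', is_adjoint T T' -> CP T' /\ K T']].
suff AC : CP `<=` A by move=> T /AC[].
have K0 : K 0.
  have := Klin (-1) _ _ (crossed_lreg 1%g) (crossed_lreg 1%g) (Kg 1%g) (Kg 1%g).
  by rewrite scaleN1r addNr.
apply: smallest_sub; last first.
  move=> T [[f _ <-]|[g _ <-]]; split=> //.
  - exact: crossed_mulop.
  - move=> T' /(adjoint_unique (mulop_adjoint f)) <-.
    by split=> //; exact: crossed_mulop.
  - exact: crossed_lreg.
  - move=> T' /(adjoint_unique (lreg_adjoint g)) <-.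
    by split=> //; exact: crossed_lreg.
split.
- split=> [|a S T [CS KS aS] [CT KT aT]].
    split=> // T' hT'; suff -> : T' = 0 by [].
    apply: adjoint_unique hT' _ => x y.
    by rewrite !bop0E (ip0l IP) (ip0r IP).
  have [S' SS] := adjoint_exists S; have [T' TT] := adjoint_exists T.
  have [CS' KS'] := aS _ SS; have [CT' KT'] := aT _ TT.
  split; [exact: Cl|exact: Klin|].
  move=> U /(adjoint_unique (adjoint_lin a SS TT)) <-.
  by split; [exact: Cl|exact: Klin].
- move=> S T [CS KS aS] [CT KT aT].
  have [S' SS] := adjoint_exists S; have [T' TT] := adjoint_exists T.
  have [CS' KS'] := aS _ SS; have [CT' KT'] := aT _ TT.
  split; [exact: Cm|exact: Kmul|].
  move=> U /(adjoint_unique (adjoint_comp SS TT)) <-.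
  by split; [exact: Cm|exact: Kmul].
- move=> S T ST [CS KS aS]; have [CT KT] := aS _ ST.
  by split=> // T' TT'; rewrite -(adjoint_unique (adjoint_sym ST) TT').
- move=> T hT; have CT : CP T.
    by apply: Cc => e /hT[S [CS _ _] Se]; exists S.
  split=> //; first by apply: Kcl => // e /hT[S [CS KS _] Se]; exists S.
  move=> T' TT'; have CT' := Ca _ _ TT' CT; split=> //.
  apply: Kcl => // e /hT[S [CS KS aS] Se].
  have [S' SS'] := adjoint_exists S; have [CS' KS'] := aS _ SS'.
  exists S'; split=> //; apply: le_lt_trans Se; apply: opnorm_le; first exact: opnorm_ge0.
  apply: (@adjoint_bound _ _ (T - S)); last exact: le_opnorm.
  have := adjoint_lin (-1) SS' TT'.
  by rewrite rmorphN rmorph1 !scaleN1r addrC (addrC _ T').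
Qed.

Lemma bop_comp1 T : bop_comp T bop1 = T. Proof. exact: bop_ext. Qed.
Lemma bop_comp1l T : bop_comp bop1 T = T. Proof. exact: bop_ext. Qed.

Lemma tlim_mulop1 (mu : beta G) (f : linf) : tlim mu (mulop f) = mulop (pi_fun mu f).
Proof. by rewrite -{1}[mulop f]bop_comp1 tlim_mulop tlim1 bop_comp1. Qed.

Lemma tlim_lreg1 (mu : beta G) g : tlim mu (lreg g : bop) = lreg g.
Proof. by rewrite -{1}[lreg g]bop_comp1 tlim_lreg tlim1 bop_comp1. Qed.

Lemma bop_compDl a S T U : bop_comp (a *: S + T) U = a *: bop_comp S U + bop_comp T U.
Proof. exact: bop_ext. Qed.

Lemma bop_compA S T U : bop_comp S (bop_comp T U) = bop_comp (bop_comp S T) U.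
Proof. exact: bop_ext. Qed.

(** Membership in the multiplicative domain is closed under norm limits; the
    two operators [L] and [L'] allow both for [L' = Psi L] and for [L' = L]. *)
Lemma module_limit (Psi : bop -> bop) (L L' X : bop) :
  (forall S T, Psi (S - T) = Psi S - Psi T) ->
  (forall T (M : R), bounded_by T M -> bounded_by (Psi T) M) ->
  (forall e : R, 0 < e -> exists S S' : bop,
     [/\ Psi (bop_comp S X) = bop_comp S' (Psi X),
         bounded_by (L - S) e & bounded_by (L' - S') e]) ->
  Psi (bop_comp L X) = bop_comp L' (Psi X).
Proof.
move=> PsiB PsiM H; apply: bop_ext => x; apply/eqP; rewrite -subr_eq0.
apply/eqP/l2norm_eq0/le_anti; rewrite l2norm_ge0 andbT.
apply/ler_addgt0Pr => e e0; rewrite add0r.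
have [M M0 XM] := bop_bound X.
pose K := M * l2norm x + l2norm (Psi X x) + 1.
have K0 : 0 < K by rewrite ltr_wpDl ?addr_ge0 ?mulr_ge0 ?l2norm_ge0.
pose d := e / K; have d0 : 0 < d by rewrite divr_gt0.
have [S [S' [E h h']]] := H d d0.
have -> : Psi (bop_comp L X) x - bop_comp L' (Psi X) x =
    Psi (bop_comp (L - S) X) x - (L' - S') (Psi X x).
  have -> : bop_comp (L - S) X = bop_comp L X - bop_comp S X by exact: bop_ext.
  by rewrite PsiB E !bopBE !bop_compE opprB addrA subrK.
apply: (le_trans (le_nrmD IP _ _)); rewrite (nrmN IP).
apply: (@le_trans _ _ (d * (M * l2norm x) + d * l2norm (Psi X x))).
  apply: lerD; last exact: h'.
  by rewrite mulrA; apply: PsiM; apply: bounded_comp => //; exact: ltW.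
rewrite -mulrDr /d -mulrA ler_piMr ?(ltW e0)//.
by rewrite mulrC ler_pdivrMr// mul1r lerDl.
Qed.

(** The crossed product lies in the left multiplicative domain of [Phi_mu],
    since its generators do. *)
Lemma tlim_crossed_comp (mu : beta G) S X : CP S ->
  tlim mu (bop_comp S X) = bop_comp (tlim mu S) (tlim mu X).
Proof.
move: S X; suff H S : CP S -> [set S | forall X,
    tlim mu (bop_comp S X) = bop_comp (tlim mu S) (tlim mu X)] S.
  by move=> S X /H.
apply: crossed_ind => /=.
- move=> a U V _ _ hU hV X.
  by rewrite bop_compDl !tlim_lin hU hV -bop_compDl.
- by move=> U V _ _ hU hV X; rewrite -bop_compA !hU hV bop_compA.
- move=> T CT hT X; apply: (module_limit (Psi := tlim mu)).
  + exact: tlimB.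
  + exact: tlim_bound.
  + move=> e /hT[U [CU hU Ue]]; exists U, (tlim mu U); split=> //.
      by move=> x; apply: (le_trans (le_opnorm _ _)); rewrite ler_wpM2r ?l2norm_ge0 ?ltW.
    rewrite -tlimB; apply: tlim_bound => x.
    by apply: (le_trans (le_opnorm _ _)); rewrite ler_wpM2r ?l2norm_ge0 ?ltW.
- by move=> f X; rewrite tlim_mulop tlim_mulop1.
- by move=> g X; rewrite tlim_lreg tlim_lreg1.
Qed.

(** Existence of [pi_w x lambda]. *)
Lemma tlim_covariant (w : beta G) : is_covariant_extension w (tlim w : bop -> bop).
Proof.
split; first split=> [a S T _ _|S T CS CT|S T CS ST].
- exact: tlim_lin.
- exact: tlim_crossed_comp.
- exact: tlim_adjoint.
move=> s; rewrite tlim_sum; apply: eq_bigr => p _.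
by rewrite tlim_mulop tlim_lreg1.
Qed.

Section PiLambda.
Variable w : beta G.
Local Notation pi := (@pi_lambda R G w).

Lemma pi_lambda_covariant : is_covariant_extension w pi.
Proof.
apply: (@xgetPex _ _ (is_covariant_extension w)).
by exists (tlim w); exact: tlim_covariant.
Qed.

Lemma one_bounded : bounded_function (fun _ : G => 1 : C).
Proof. by exists 1 => g; rewrite cabs1. Qed.

Lemma mulop1 : mulop (Linf one_bounded) = bop1 :> bop.
Proof. by apply: bop_ext => x; apply: l2_ext => g /=; rewrite mul1r. Qed.

Lemma pi_fun1 : mulop (pi_fun w (Linf one_bounded)) = bop1 :> bop.
Proof. by rewrite -tlim_mulop1 mulop1 tlim1. Qed.

Lemma pi_mulop_lreg (f : linf) g :
  pi (bop_comp (mulop f) (lreg g)) = bop_comp (mulop (pi_fun w f)) (lreg g).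
Proof. by have [_ /(_ [:: (f, g)])] := pi_lambda_covariant; rewrite !big_seq1. Qed.

Lemma pi_mulop (f : linf) : pi (mulop f) = mulop (pi_fun w f).
Proof. by have := pi_mulop_lreg f 1%g; rewrite lreg1 !bop_comp1. Qed.

Lemma pi_lreg g : pi (lreg g) = lreg g.
Proof. by have := pi_mulop_lreg (Linf one_bounded) g; rewrite pi_fun1 mulop1 !bop_comp1l. Qed.

Lemma pi1 : pi bop1 = bop1.
Proof. by rewrite -lreg1 pi_lreg. Qed.

(** The formula on finite sums determines [pi] only up to continuity, which is
    automatic for *-homomorphisms. *)
Lemma pi_contractive T : CP T -> bounded_by (pi T) (opnorm T).
Proof.
have [pih _] := pi_lambda_covariant.
exact: star_homomorphism_contractive crossed_cstar crossed1 pih pi1.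
Qed.

(** For the generators [M_h], with [h g = f (g . w)], and [U_g], multiplying by
    them commutes with [Phi_mu]. The elements with this property, unlike the
    fixed points of [Phi_mu], are stable under products. *)
Lemma tlim_fixes_orbit (mu : beta G) :
  (forall f : linf, pi_fun mu (pi_fun w f) = pi_fun w f :> (G -> C)) ->
  fixes (@orbit_algebra R G w) (tlim mu).
Proof.
move=> fix_f _ [T CT <-].
suff H : [set T | forall X, tlim mu (bop_comp (pi T) X) = bop_comp (pi T) (tlim mu X)] T.
  by have := H bop1; rewrite tlim1 !bop_comp1.
have [[pil pim _] _] := pi_lambda_covariant.
have [[C0 Cl] _ _ _] := crossed_cstar.
have piB U V : CP U -> CP V -> pi (U - V) = pi U - pi V.
  by move=> CU CV; rewrite addrC -scaleN1r pil// scaleN1r addrC.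
move: T CT; apply: crossed_ind => /=.
- move=> a U V CU CV hU hV X.
  by rewrite pil// !bop_compDl tlim_lin hU hV.
- by move=> U V CU CV hU hV X; rewrite pim// -!bop_compA hU hV.
- move=> T CT hT X; apply: (module_limit (Psi := tlim mu)).
  + exact: tlimB.
  + exact: tlim_bound.
  + move=> e /hT[U [CU hU Ue]]; exists (pi U), (pi U).
    suff h : bounded_by (pi T - pi U) e by split.
    have CTU : CP (T - U) by rewrite addrC -scaleN1r; exact: Cl.
    rewrite -piB// => x; apply: (le_trans (pi_contractive CTU x)).
    by rewrite ler_wpM2r ?l2norm_ge0 ?ltW.
- move=> f X; rewrite pi_mulop tlim_mulop; congr bop_comp.
  apply: bop_ext => x; apply: l2_ext => g /=.
  by rewrite -[LHS]/(pi_fun mu (pi_fun w f) g * x g) fix_f.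
- by move=> g X; rewrite pi_lreg tlim_lreg.
Qed.

End PiLambda.
End CrossedProduct.

(** * The compact semigroup of ultrafilters *)

Section Ultrafilters.
Context {G : groupType}.
Implicit Types (u v w : beta G) (A : set G) (X M S : set (beta G)).

Lemma ufilterI w A B : ufilter w A -> ufilter w B -> ufilter w (A `&` B).
Proof. by have FU := ufilterP w; exact: filterI. Qed.
Lemma ufilterS w A B : A `<=` B -> ufilter w A -> ufilter w B.
Proof. by have FU := ufilterP w; exact: filterS. Qed.
Lemma ufilterT w : ufilter w setT.
Proof. by have FU := ufilterP w; exact: filterT. Qed.
Lemma ufilter_ex w A : ufilter w A -> A !=set0.
Proof. by have FU := ufilterP w; exact: filter_ex. Qed.
Lemma ufilterC w A : ~ ufilter w A -> ufilter w (~` A).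
Proof. by move=> wA; have [] := in_ultra_setVsetC A (ufilterP w). Qed.
Lemma ufilterCN w A : ufilter w (~` A) -> ~ ufilter w A.
Proof. by move=> wA wA'; have [t []] := ufilter_ex (ufilterI wA wA'). Qed.

Lemma beta_eq u v : ufilter u `<=` ufilter v -> u = v.
Proof.
move=> uv; have : ufilter v = ufilter u.
  by apply: (@max_filter _ _ (ufilterP u)) => //; exact: (@ultra_proper _ _ (ufilterP v)).
case: u v {uv} => [F FU] [F' FU'] /= E; case: _ / E FU FU' => FU FU'.
by congr Beta; exact: Prop_irrelevance.
Qed.

Lemma bmul_subproof u v :
  UltraFilter [set A | ufilter u [set h | ufilter (beta_act h v) A]].
Proof.
apply: ultra_dichotomy.
  apply: Build_ProperFilter_ex.
    by move=> A /ufilter_ex[h /ufilter_ex].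
  split=> [|A B|A B AB].
  - by apply: ufilterS (ufilterT u) => h _; exact: ufilterT.
  - move=> uA uB; apply: ufilterS (ufilterI uA uB) => h [hA hB].
    exact: ufilterI.
  - by apply: ufilterS => h; exact: ufilterS.
move=> A; have [uA|uA] := pselect (ufilter u [set h | ufilter (beta_act h v) A]).
  by left.
by right; apply: ufilterS (ufilterC uA) => h; exact: ufilterC.
Qed.

(** The product of the compact semigroup [beta G]: the limit of [h . v] as [h]
    tends to [u]. *)
Definition bmul u v : beta G := Beta (bmul_subproof u v).

Lemma bmulE u v A : ufilter (bmul u v) A = ufilter u [set h | ufilter v [set k | A (h * k)%g]].
Proof. by []. Qed.

Lemma bmulA u v w : bmul u (bmul v w) = bmul (bmul u v) w.
Proof.
apply: beta_eq => A; rewrite !bmulE; apply: ufilterS => g /=.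
by apply: ufilterS => h /=; apply: ufilterS => k /=; rewrite mulgA.
Qed.

(** The closure for the topology of [beta G], in terms of its base. *)
Definition bclosure X : set (beta G) :=
  [set w | forall A, ufilter w A -> exists2 v, X v & ufilter v A].

Definition bclosed X := bclosure X `<=` X.

Lemma bclosureS X Y : X `<=` Y -> bclosure X `<=` bclosure Y.
Proof. by move=> XY w Xw A /Xw[v /XY]; exists v. Qed.

Lemma bclosure_base A X : X `<=` beta_base A -> bclosure X `<=` beta_base A.
Proof.
move=> XA w Xw; apply: contrapT => /ufilterC /Xw[v /XA vA].
by move=> /ufilterCN.
Qed.

(** Compactness of [beta G]: take an ultrafilter that contains each [A] shared by
    all the members of some [f i]. *)
Lemma beta_cluster (I : Type) (D : set I) (f : I -> set (beta G)) :
  D !=set0 -> (forall i, D i -> f i !=set0) ->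
  (forall i j, D i -> D j -> exists2 k, D k & f k `<=` f i `&` f j) ->
  exists w, forall i, D i -> bclosure (f i) w.
Proof.
move=> [i0 Di0] f0 fI.
pose F : set_system G := [set A | exists2 i, D i & f i `<=` beta_base A].
have FF : ProperFilter F.
  apply: Build_ProperFilter_ex.
    by move=> A [i /f0[v iv] iA]; exact: ufilter_ex (iA _ iv).
  split=> [|A B [i Di iA] [j Dj jB]|A B AB [i Di iA]].
  - by exists i0 => // v _; exact: ufilterT.
  - have [k Dk kij] := fI i j Di Dj; exists k => // v /kij[/iA vA /jB vB].
    exact: ufilterI.
  - by exists i => // v /iA; exact: ufilterS.
have [F' [F'U FF']] := ultraFilterLemma FF.
exists (Beta F'U) => i Di A /= F'A; apply: contrapT => H.
have /FF' F'C : F (~` A).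
  by exists i => // v iv; apply: ufilterC => vA; apply: H; exists v.
by have /filter_ex[t []] : F' (A `&` ~` A) by exact: filterI.
Qed.

(** Right multiplication is continuous (left multiplication need not be). *)
Lemma bclosed_preimage s t : bclosed [set m | bmul m s = t].
Proof.
move=> w wcl; apply/esym/beta_eq => A tA.
apply: (bclosure_base _ wcl) => m /= E.
by move: tA; rewrite -E.
Qed.

Definition subsemigroup S := forall u v, S u -> S v -> S (bmul u v).

(** The Ellis-Numakura lemma. For [s] in a minimal closed subsemigroup [M], the
    closed subsemigroup [M s] is all of [M], so [m s = s] for some [m] in [M];
    then the closed subsemigroup of all such [m] is also [M], and contains [s]. *)
Lemma ellis S : S !=set0 -> bclosed S -> subsemigroup S ->
  exists2 e, S e & bmul e e = e.
Proof.
move=> S0 Scl Smul.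
pose Q X := [/\ X !=set0, bclosed X & subsemigroup X].
(* complements, since Zorn's lemma below produces maximal sets *)
pose P := [set X : set (beta G) | Q (S `&` ~` X)].
have [|N [QN Nmin]] := @Zorn_bigcup (beta G) P.
  move=> F FP Ftot; have [[X0 FX0]|F0] := pselect (F !=set0); last first.
    rewrite /P /= (_ : S `&` _ = S); first by split.
    by apply/seteqP; split=> [w []//|w Sw]; split=> // -[X FX]; case: F0; exists X.
  split.
  - have [|X /FP[]//|X Y FX FY|w wcl] := @beta_cluster _ F (fun X => S `&` ~` X).
    + by exists X0.
    + have [XY|YX] := Ftot _ _ FX FY.
        by exists Y => // w [Sw nY]; split; split=> // /XY.
      by exists X => // w [Sw nX]; split; split=> // /YX.
    + exists w; split.
        by have [_ cl _] := FP _ FX0; have [] := cl _ (wcl _ FX0).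
      move=> [X FX]; have [_ cl _] := FP _ FX; by have [] := cl _ (wcl _ FX).
  - move=> w wcl; split; first by apply: Scl; apply: bclosureS wcl => v [].
    move=> [X FX]; have [_ cl _] := FP _ FX.
    suff [] : (S `&` ~` X) w by [].
    apply: cl; apply: bclosureS wcl => v [Sv nF]; split=> // Xv.
    by apply: nF; exists X.
  - move=> u v [Su nu] [Sv nv]; split; first exact: Smul.
    move=> [X FX]; have [_ _ ml] := FP _ FX.
    suff [] : (S `&` ~` X) (bmul u v) by [].
    by apply: ml; split=> // Xw; [apply: nu|apply: nv]; exists X.
pose M := S `&` ~` N; have {}QM : Q M by [].
have Mmin X : Q X -> X `<=` M -> X = M.
  move=> QX XM; apply/seteqP; split=> // w Mw; apply: contrapT => nX.
  apply: (Nmin (~` X)).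
    split; first by move=> v Nv /XM[].
    by move=> /(_ w nX); case: Mw.
  rewrite /P /= setCK (_ : S `&` X = X)//.
  by apply/seteqP; split=> [v []//|v Xv]; split=> //; case: (XM _ Xv).
have [[s Ms] Mcl Mmul] := QM.
have Ms_all : [set bmul m s | m in M] = M.
  apply: Mmin; last by move=> _ [m Mm <-]; exact: Mmul.
  split.
  - by exists (bmul s s), s.
  - move=> u ucl.
    have [|A uA|A B uA uB|m mcl] := @beta_cluster _ (ufilter u)
      (fun A => M `&` beta_base [set h | ufilter (beta_act h s) A]).
    + by exists setT; exact: ufilterT.
    + by have [_ [m Mm <-] mA] := ucl _ uA; exists m.
    + exists (A `&` B); first exact: ufilterI.
      move=> m [Mm mAB]; split; split=> //; apply: ufilterS mAB => h;
        by apply: ufilterS => k [].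
    + exists m; first by apply: Mcl; apply: bclosureS (mcl _ (ufilterT u)) => v [].
      apply/esym/beta_eq => A uA; apply: (bclosure_base _ (mcl _ uA)).
      by move=> v [].
  - move=> _ _ [m Mm <-] [m' Mm' <-]; exists (bmul (bmul m s) m').
      by apply: (Mmul) => //; exact: Mmul.
    by rewrite !bmulA.
have [m Mm ms] : [set bmul m s | m in M] s by rewrite Ms_all.
have stab : M `&` [set m | bmul m s = s] = M.
  apply: Mmin; last by move=> v [].
  split.
  - by exists m.
  - move=> w wcl; split; first by apply: Mcl; apply: bclosureS wcl => v [].
    by apply: bclosed_preimage; apply: bclosureS wcl => v [].
  - by move=> u v [Mu us] [Mv vs]; split; [exact: Mmul|rewrite /= -bmulA vs].
exists s; first by case: Ms.
by have [] : (M `&` [set m | bmul m s = s]) s by rewrite stab.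
Qed.

(** A recurrent point returns infinitely often: a finite set of return times
    contains the stabiliser, which is then a finite subgroup, hence trivial, and
    a smaller neighbourhood excludes the other return times. This leaves room
    for a non-principal ultrafilter of return times. *)
Lemma recurrent_idempotent w :
  no_nontrivial_finite_subgroup G -> ~ non_recurrent w ->
  exists e : beta G, [/\ bmul e e = e, bmul e w = w & ~ ufilter e [set 1%g]].
Proof.
move=> Gtf wrec.
pose ret A : set G := [set h | ufilter (beta_act h w) A].
have ret_inf A : ufilter w A -> ~ finite_set (ret A).
  move=> wA fA; apply: wrec.
  pose H := [set h | beta_act h w = w].
  have actM g h : beta_act (g * h)%g w = beta_act g (beta_act h w).
    by apply: beta_eq => B; apply: (@ufilterS w) => k /=; rewrite mulgA.
  have act1 : beta_act 1%g w = w.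
    by apply: beta_eq => B; apply: (@ufilterS w) => k /=; rewrite mul1g.
  have HA : H `<=` ret A by move=> h hw; rewrite -(hw : beta_act h w = w) in wA.
  have H1 : H = [set 1%g].
    apply: Gtf; last exact: sub_finite_set HA fA.
    split; first by rewrite inE.
    move=> g h; rewrite !inE => gw hw.
    have hVw : beta_act h^-1 w = w by rewrite -{1}hw -actM mulVg act1.
    by rewrite /H /= actM hVw.
  have sep h : exists B, ufilter w B /\ (h <> 1%g -> ~ ufilter (beta_act h w) B).
    have [->|h1] := eqVneq h 1%g; first by exists setT; split; [exact: ufilterT|].
    apply: contrapT => /forallNP K; suff : H h by rewrite H1 => /eqP; rewrite (negbTE h1).
    apply/esym/beta_eq => B wB; apply: contrapT => hB.
    by apply: (K B).
  have [B hB] := choice sep.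
  pose A' := A `&` \bigcap_(h in ret A) B h.
  have wA' : ufilter w A'.
    apply: ufilterI => //; have FU := ufilterP w.
    by move: fA => /finite_fsetP[D ->]; apply: filter_bigI => h _; case: (hB h).
  exists (beta_base A'); split=> //.
    by exists [set A'] => //; rewrite bigcup_set1.
  move=> g g1 gA'; have gA : ret A g by apply: ufilterS gA' => h [].
  have [_ /(_ g1)] := hB g; apply.
  by apply: ufilterS gA' => h [_ /(_ g gA)].
(* With all principal ultrafilters excluded, and not only the one at the
   identity, stability under products is immediate. *)
pose S := [set u : beta G | bmul u w = w /\ forall g, ~ ufilter u [set g]].
have Scl : bclosed S.
  move=> u ucl; split.
    by apply: bclosed_preimage; apply: bclosureS ucl => v [].
  by move=> g /ucl[v [_ /(_ g)]].
have Smul : subsemigroup S.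
  move=> u v [uw un] [vw vn]; split; first by rewrite -bmulA vw.
  move=> g; rewrite bmulE => /ufilter_ex[h /= vh]; apply: (vn (h^-1 * g)%g).
  by apply: ufilterS vh => k /= <-; rewrite mulKg.
have S0 : S !=set0.
  pose D := [set p : set G * set G | ufilter w p.1 /\ finite_set p.2].
  have [|p [wp fp]|p q [wp fp] [wq fq]|u ucl] := @beta_cluster _ D
      (fun p => beta_base (ret p.1 `\` p.2)).
  - by exists (setT, set0); split; [exact: ufilterT|exact: finite_set0].
  - have : ret p.1 `\` p.2 !=set0.
      apply/set0P/negP => /eqP; rewrite setD_eq0 => sub; apply: (ret_inf _ wp).
      exact: sub_finite_set sub fp.
    move=> [h hp]; exists (Beta (principal_filter_ultra h)).
    exact/principal_filterP.
  - exists (p.1 `&` q.1, p.2 `|` q.2).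
      by split; [exact: ufilterI|rewrite /= finite_setU].
    move=> u upq; split; apply: ufilterS upq => h /= [hr /not_orP[hp hq]]; split=> //.
      by apply: ufilterS hr => k [].
    by apply: ufilterS hr => k [].
  - have uB p : D p -> ufilter u (ret p.1 `\` p.2).
      by move=> /ucl; apply: bclosure_base.
    exists u; split.
      apply/esym/beta_eq => A wA.
      by apply: ufilterS (uB (A, set0) _) => [h []//|]; split=> //; exact: finite_set0.
    move=> g ug; have : ufilter u (ret setT `\` [set g]).
      by apply: (uB (setT, [set g])); split; [exact: ufilterT|exact: finite_set1].
    by move=> /(ufilterI ug)/ufilter_ex[h [/= hg [_]]].
have [e [ew en] ee] := ellis S0 Scl Smul.
by exists e; split.
Qed.
End Ultrafilters.

Section IteratedLimits.
Context {R : realType} {G : groupType}.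
Local Notation C := (Cplx R).

Lemma cvg_bmul (u v : beta G) (f F : G -> C) (l : C) :
  (forall h, (fun k => f (h * k)%g) @ ufilter v --> F h) ->
  f @ ufilter (bmul u v) --> l -> F @ ufilter u --> l.
Proof.
move=> fF fl.
have FU := ufilterP u; have FV := ufilterP v; have FUV := ufilterP (bmul u v).
apply/cvgCP => e e0; have e2 : 0 < e / 2 by rewrite divr_gt0.
have H : ufilter u [set h | ufilter v [set k | cabs (f (h * k)%g - l) < e / 2]].
  exact: (iffLR (@cvgCP R G (ufilter (bmul u v)) _ f l) fl _ e2).
apply: ufilterS H => h /= hA.
have hB : ufilter v [set k | cabs (f (h * k)%g - F h) < e / 2].
  exact: (iffLR (@cvgCP R G (ufilter v) _ _ (F h)) (fF h) _ e2).
have [k [/= kA kB]] := ufilter_ex (ufilterI hA hB).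
rewrite (_ : F h - l = (F h - f (h * k)%g) + (f (h * k)%g - l)); last by ring.
apply: (le_lt_trans (le_cabsD _ _)); rewrite [ltRHS]splitr.
by apply: ltrD => //; rewrite cabsBC.
Qed.

Lemma cvg_pi_fun (w : beta G) (f : @linf R G) g :
  (fun k => f (g * k)%g) @ ufilter w --> (pi_fun w f g : C).
Proof.
have [M fM] := @linfP _ _ f.
exact: (@ultra_bounded_cvg R G (ufilter w) (ufilterP w) (fun k => f (g * k)%g) M).
Qed.

Lemma pi_fun_bmul (u v : beta G) (f : @linf R G) g :
  pi_fun u (pi_fun v f) g = pi_fun (bmul u v) f g.
Proof.
have FU := ufilterP u.
apply: (@cvgC_unique R G (ufilter u) _ _ _ _ (@cvg_pi_fun u (pi_fun v f) g)).
apply: (@cvg_bmul u v (fun k => f (g * k)%g)) => [h|]; last exact: cvg_pi_fun.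
rewrite (_ : (fun k => _) = fun k => f (g * h * k)%g); first exact: cvg_pi_fun.
by apply/funext => k; rewrite mulgA.
Qed.

Lemma tlim_bmul (u v : beta G) (T : bop R G) : tlim u (tlim v T) = tlim (bmul u v) T.
Proof.
apply: bop_ext => x; apply: tlimP => b.
apply: (@cvg_bmul u v (fun m => T (rreg m x) (b * m)%g)
  (fun h => tlim v T (rreg h x) (b * h)%g)).
- move=> h.
  have E : (fun k => T (rreg (h * k)%g x) (b * (h * k))%g) =
      (fun k => T (rreg k (rreg h x)) (b * h * k)%g).
    by apply/funext => k; rewrite rreg_rreg mulgA.
  by rewrite E; exact: cvg_tlim.
- exact: cvg_tlim.
Qed.

End IteratedLimits.

(** * Matrices of operators *)

Section OperatorMatrices.
Context {R : realType} {X : choiceType}.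
Local Notation C := (Cplx R).
Local Notation l2 := (l2 R X).
Local Notation bop := (bop R X).
Local Notation IP := (@l2_inner_space R X).

Definition tuple_inner n (x y : 'I_n -> l2) : C := \sum_i l2inner (x i) (y i).

Lemma tuple_norm_sqr n (x : 'I_n -> l2) : tuple_norm x ^+ 2 = \sum_i l2norm (x i) ^+ 2.
Proof. by apply: sqr_sqrtr; apply: sumr_ge0 => i _; exact: sqr_ge0. Qed.

Lemma tuple_inner_space n : inner_space (@tuple_inner n) (@tuple_norm R X n).
Proof.
split=> [a x y z|x y|x|x].
- rewrite /tuple_inner mulr_sumr -big_split /=; apply: eq_bigr => i _.
  exact: (ipl IP).
- by rewrite /tuple_inner rmorph_sum; apply: eq_bigr => i _; exact: (ipJ IP).
- exact: sqrtr_ge0.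
- by rewrite tuple_norm_sqr /tuple_inner ofR_sum; apply: eq_bigr => i _; exact: (ipxx IP).
Qed.
Local Notation TP n := (tuple_inner_space n).

Lemma mx_app_lin n (T : 'M[bop]_n) a x y :
  mx_app T (a *: x + y) = a *: mx_app T x + mx_app T y.
Proof.
apply/funext => i; rewrite /mx_app.
have -> : (a *: (mx_app T x) + mx_app T y) i = a *: mx_app T x i + mx_app T y i by [].
rewrite /mx_app scaler_sumr -big_split /=; apply: eq_bigr => j _.
exact: bop_linear.
Qed.

Lemma mx_appZ n (T : 'M[bop]_n) a x : mx_app T (a *: x) = a *: mx_app T x.
Proof.
have E := mx_app_lin T a x 0; rewrite addr0 in E; rewrite E.
suff -> : mx_app T 0 = 0 by rewrite addr0.
by apply/funext => i; rewrite /mx_app big1// => j _; rewrite bop0.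
Qed.

Lemma l2norm_sum I (r : seq I) (P : pred I) (F : I -> l2) :
  l2norm (\sum_(i <- r | P i) F i) <= \sum_(i <- r | P i) l2norm (F i).
Proof.
elim/big_rec2: _ => [|i u v _ h]; first by rewrite (nrm0 IP).
by apply: (le_trans (le_nrmD IP _ _)); rewrite lerD2l.
Qed.

Lemma mx_app_bound n (T : 'M[bop]_n) : exists2 c : R, 0 <= c &
  forall x, tuple_norm (mx_app T x) <= c * tuple_norm x.
Proof.
pose s i := \sum_j opnorm (T i j).
have s0 i : 0 <= s i by apply: sumr_ge0 => j _; exact: opnorm_ge0.
exists (Num.sqrt (\sum_i s i ^+ 2)) => [|x]; first exact: sqrtr_ge0.
have N0 := nrm_ge0 (TP n) x.
have S0 : 0 <= \sum_i s i ^+ 2 by apply: sumr_ge0 => i _; exact: sqr_ge0.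
have xn j : l2norm (x j) <= tuple_norm x.
  rewrite -(@ler_sqr R) ?nnegrE ?l2norm_ge0// tuple_norm_sqr.
  by rewrite (bigD1 j)//= lerDl; apply: sumr_ge0 => i _; exact: sqr_ge0.
rewrite -(@ler_sqr R) ?nnegrE ?mulr_ge0 ?sqrtr_ge0 ?(nrm_ge0 (TP n))// exprMn.
rewrite [X in X * _]sqr_sqrtr// [leLHS]tuple_norm_sqr mulr_suml.
apply: ler_sum => i _; rewrite -exprMn ler_sqr ?nnegrE ?l2norm_ge0 ?mulr_ge0//.
apply: (le_trans (l2norm_sum _ _ _)); rewrite mulr_suml; apply: ler_sum => j _.
by apply: (le_trans (le_opnorm _ _)); rewrite ler_wpM2l ?opnorm_ge0.
Qed.

Lemma le_mx_opnorm n (T : 'M[bop]_n) x :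
  tuple_norm (mx_app T x) <= mx_opnorm T * tuple_norm x.
Proof.
have [c _ Tc] := mx_app_bound T.
exact: (nrm_le_sup (TP n) (mx_appZ T) Tc).
Qed.

Lemma mx_opnorm_le n (T : 'M[bop]_n) (c : R) : 0 <= c ->
  (forall x, tuple_norm (mx_app T x) <= c * tuple_norm x) -> mx_opnorm T <= c.
Proof. by move=> c0 Tc; exact: (sup_le_bound (TP n) Tc). Qed.

(** The disks are those of centre [c + it] through [0], scaled by [n]; for fixed
    [c], their intersection over all [t] is the segment from [0] to [2 c n]. *)
Lemma disk_intersection (v : C) (n c0 : R) : 0 <= n -> 0 <= c0 ->
  (forall c t : R, c0 <= c ->
     cabs (ofR n * (c +i* t)%C - v) ^+ 2 <= (c ^+ 2 + t ^+ 2) * n ^+ 2) -> 0 <= v.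
Proof.
move=> n0 c00 H; case: v H => a b H.
have {}H c t : c0 <= c -> a ^+ 2 + b ^+ 2 <= 2 * (c * n * a + t * n * b).
  move=> /(H c t); rewrite sqr_cabs reCD imCD reCN imCN /reC /imC /= !mul0r.
  by rewrite subr0 addr0; lra.
have [nz|nz] := eqVneq n 0.
  have := H c0 0 (lexx _); rewrite nz !(mulr0, mul0r) addr0 mulr0 => h.
  have := sqr_ge0 a; have := sqr_ge0 b => hb ha.
  have a0 : a ^+ 2 == 0 by rewrite eq_le ha andbT; lra.
  have b0 : b ^+ 2 == 0 by rewrite eq_le hb andbT; lra.
  by move: a0 b0; rewrite !sqrf_eq0 => /eqP-> /eqP->.
have np : 0 < n by rewrite lt_neqAle eq_sym nz.
have b0 : b = 0.
  apply/eqP/negP => /negP bn.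
  (* t is chosen so that the right hand side is negative *)
  have := H c0 (- (c0 * n * a + 1) / (n * b)) (lexx _).
  rewrite (_ : _ + _ / _ * n * b = -1); last by field; rewrite bn nz.
  by have := sqr_ge0 a; have := sqr_ge0 b; lra.
subst b; apply: geC0 => //; rewrite /reC /= leNgt; apply/negP => a0.
have := H (c0 + 1) 0; rewrite lerDl => /(_ ler01).
rewrite expr0n /= !mulr0 !addr0.
have : 0 < a ^+ 2 by rewrite exprn_even_gt0//= lt_eqF.
have : (c0 + 1) * n * a < 0 by rewrite pmulr_rlt0// mulr_gt0// ltr_wpDl.
lra.
Qed.

(** The disks of [positive_disk] are described by norms, so a unital contraction
    keeps the numerical range of the image of [T] inside each of them. *)
Lemma unital_contraction_positive (E : set bop) (u : bop -> bop) :
  (forall (a : C) S T, E S -> E T -> E (a *: S + T)) -> E bop1 ->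
  (forall (a : C) S T, E S -> E T -> u (a *: S + T) = a *: u S + u T) ->
  u bop1 = bop1 ->
  forall n (T : 'M[bop]_n),
  (forall T' : 'M[bop]_n, (forall i j, E (T' i j)) ->
     mx_opnorm (map_mx u T') <= mx_opnorm T') ->
  (forall i j, E (T i j)) -> mx_positive T -> mx_positive (map_mx u T).
Proof.
move=> El E1 ul u1 n T uc ET Tpos x.
have E0 : E 0 by have := El (-1) _ _ E1 E1; rewrite scaleN1r addNr.
have u0 : u 0 = 0 by have := ul (-1) 0 0 E0 E0; rewrite scaler0 addr0 scaleN1r addNr.
have [c0 c00 Tc0] := mx_app_bound T.
rewrite -[X in 0 <= X]/(tuple_inner (mx_app (map_mx u T) x) x).
apply: (@disk_intersection _ (tuple_norm x ^+ 2) c0) => //; first exact: sqr_ge0.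
move=> c t cc0; have c_ge0 := le_trans c00 cc0.
pose z : C := (c +i* t)%C.
pose dg i j : bop := if i == j :> 'I_n then z *: bop1 else 0.
pose Z : 'M[bop]_n := \matrix_(i, j) (dg i j - T i j).
have Edg i j : E (dg i j).
  by rewrite /dg; case: eqP => _ //; rewrite -[_ *: _]addr0; exact: El.
have udg i j : u (dg i j) = dg i j.
  by rewrite /dg; case: eqP => _ //; rewrite -[_ *: _]addr0 ul// u1 u0.
have EZ i j : E (Z i j) by rewrite mxE addrC -scaleN1r; exact: El.
have dgE (S : 'M[bop]_n) y : mx_app (\matrix_(i, j) (dg i j - S i j)) y = z *: y - mx_app S y.
  apply/funext => i.
  have -> : (z *: y - mx_app S y) i = z *: y i - mx_app S y i by [].
  rewrite {1}/mx_app; under eq_bigr do rewrite mxE bopBE.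
  rewrite sumrB; congr (_ - _); rewrite (bigD1 i)//= /dg eqxx bopZE big1 ?addr0//.
  by move=> j ji; rewrite eq_sym (negbTE ji).
have uZ : map_mx u Z = \matrix_(i, j) (dg i j - map_mx u T i j).
  apply/matrixP => i j; rewrite !mxE addrC -scaleN1r ul// udg scaleN1r addrC.
  by [].
pose K := Num.sqrt (c ^+ 2 + t ^+ 2).
have K2 : K ^+ 2 = c ^+ 2 + t ^+ 2 by rewrite sqr_sqrtr// addr_ge0 ?sqr_ge0.
have K0 : 0 <= K by exact: sqrtr_ge0.
have ZK : mx_opnorm Z <= K.
  apply: mx_opnorm_le => // y; rewrite -(@ler_sqr R) ?nnegrE ?mulr_ge0 ?(nrm_ge0 (TP n))//.
  rewrite exprMn K2 dgE; apply: (positive_disk (TP n)) => //.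
  - exact: mx_app_lin.
  - move=> y'; apply: (le_trans (Tc0 y')).
    by rewrite ler_wpM2r ?(nrm_ge0 (TP n)).
have h : tuple_norm (z *: x - mx_app (map_mx u T) x) <= K * tuple_norm x.
  rewrite -dgE -uZ; apply: (le_trans (le_mx_opnorm _ _)).
  rewrite ler_wpM2r ?(nrm_ge0 (TP n))//.
  by apply: le_trans ZK; exact: uc.
have := le_ip_nrm (TP n) (z *: x - mx_app (map_mx u T) x) x.
rewrite (ipBl (TP n)) (ipZl (TP n)) (ipxx (TP n)) mulrC => h2.
have tx0 := nrm_ge0 (TP n) x.
rewrite -K2 -exprMn ler_sqr ?nnegrE ?cabs_ge0 ?mulr_ge0 ?sqr_ge0//.
apply: (le_trans h2); rewrite expr2 mulrA ler_wpM2r//.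
Qed.

(** Cauchy-Schwarz for the form of [T]: isotropic vectors lie in its kernel. *)
Lemma mx_positive_CS n (T : 'M[bop]_n) x y : mx_positive T ->
  tuple_inner (mx_app T x) x = 0 -> tuple_inner (mx_app T x) y = 0.
Proof.
move=> Tpos x0; apply: cabs0_eq0; apply/eqP; rewrite -sqrf_eq0 eq_le sqr_ge0 andbT.
have := @form_CS R _ (fun u v => tuple_inner (mx_app T u) v) _ _ Tpos x y.
rewrite x0 [reC 0]/= mul0r; apply.
- by move=> a u v s; rewrite mx_app_lin (ipl (TP n)).
- by move=> a u v s; rewrite (ipr (TP n)).
Qed.

End OperatorMatrices.

(** * Rigidity of the matrix units *)

Section MatrixUnits.
Context {R : realType} {X : choiceType}.
Local Notation C := (Cplx R).
Local Notation l2 := (l2 R X).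
Local Notation bop := (bop R X).
Local Notation IP := (@l2_inner_space R X).
Local Notation TP n := (@tuple_inner_space R X n).
Implicit Types (S T P Q D : bop) (x y : l2).

Definition block (P D D' Q : bop) : 'M[bop]_2 :=
  \matrix_(i, j) (if i == 0 then if j == 0 then P else D else if j == 0 then D' else Q).

Definition pair_vec x y : 'I_2 -> l2 := fun i => if i == 0 then x else y.

Lemma block_inner P D D' Q x y x' y' :
  tuple_inner (mx_app (block P D D' Q) (pair_vec x y)) (pair_vec x' y') =
  l2inner (P x + D y) x' + l2inner (D' x + Q y) y'.
Proof.
rewrite /tuple_inner big_ord_recl big_ord1 /mx_app !big_ord_recl !big_ord0.
by rewrite !mxE /= !addr0.
Qed.

(** The quadratic form at [(x, y)] is at least [(p x - q y) ^ 2]. *)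
Lemma block_positive (p q : l2 -> R) (P D D' Q : bop) :
  is_adjoint D D' ->
  (forall x, l2inner (P x) x = ofR (p x ^+ 2)) ->
  (forall y, l2inner (Q y) y = ofR (q y ^+ 2)) ->
  (forall x y, cabs (l2inner (D y) x) <= p x * q y) ->
  mx_positive (block P D D' Q).
Proof.
move=> DD' pE qE H z.
have -> : z = pair_vec (z 0) (z 1).
  apply/funext => i; rewrite /pair_vec; case: eqP => [->//|i0]; congr z.
  by apply: val_inj; case: i i0 => -[|[|]]//= h; case; exact: val_inj.
rewrite -[X in 0 <= X]/(tuple_inner (mx_app (block P D D' Q)
  (pair_vec (z 0) (z 1))) (pair_vec (z 0) (z 1))).
rewrite block_inner; move: (z 0) (z 1) => x y; have h := H x y.
rewrite !(ipDl IP) pE qE (adjoint_sym DD') (ipJ IP (D y) x).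
set w := l2inner (D y) x in h *.
have r := reC_le w; have := ler_norm (- reC w); rewrite normrN => r2.
apply: geC0; first by case: (w) => a b; rewrite /imC /=; ring.
have : reC (ofR (p x ^+ 2) + w + (w^* + ofR (q y ^+ 2))) = p x ^+ 2 + 2 * reC w + q y ^+ 2.
  by case: (w) => a b; rewrite /reC /=; ring.
move=> ->; have := sqr_ge0 (p x - q y); rewrite sqrrB => h2.
have h3 : - reC w <= p x * q y by apply: le_trans h; apply: le_trans r.
lra.
Qed.

Lemma mx_positive_CSr n (T : 'M[bop]_n) u v : mx_positive T ->
  tuple_inner (mx_app T v) v = 0 -> tuple_inner (mx_app T u) v = 0.
Proof.
move=> Tpos v0; have h := @mx_positive_CS R X n T v u Tpos v0.
have := @form_herm R _ (fun u v => tuple_inner (mx_app T u) v) _ _ Tpos v u.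
rewrite h rmorph0; apply.
- by move=> a x y s; rewrite mx_app_lin (ipl (TP n)).
- by move=> a x y s; rewrite (ipr (TP n)).
Qed.

Lemma matunit_bounded a b : bounded_by (fun x : l2 => x b *: delta a : l2) 1.
Proof.
move=> x; rewrite (nrmZ IP) mul1r.
have -> : l2norm (delta a : l2) = 1.
  have := ipxx IP (delta a); rewrite l2inner_basis deltaE eqxx.
  have -> : (true%:R : C) = ofR 1 by [].
  by move=> /ofR_inj/esym/eqP; rewrite sqrp_eq1 ?l2norm_ge0// => /eqP.
by rewrite mulr1 cabs_le_l2norm.
Qed.

Lemma matunit_linear a b c x y :
  (c *: x + y) b *: delta a = c *: (x b *: delta a) + y b *: delta a :> l2.
Proof. by rewrite l2D l2Z scalerDl scalerA. Qed.

Definition matunit a b : bop := mkbop (matunit_linear a b) (matunit_bounded a b).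

Lemma matunitE a b x : matunit a b x = x b *: delta a. Proof. by []. Qed.

(** The projection onto the orthogonal complement of the basis vector. *)
Definition coproj a : bop := bop1 - matunit a a.

Lemma coprojE a x : coproj a x = x - x a *: delta a. Proof. by []. Qed.

Lemma coproj_delta a : coproj a (delta a) = 0.
Proof. by rewrite coprojE deltaE eqxx scale1r subrr. Qed.

Lemma coproj_sym a x y : l2inner (coproj a x) y = l2inner x (coproj a y).
Proof.
rewrite !coprojE (ipBl IP) (ipBr IP) (ipZl IP) (ipZr IP) l2inner_basis.
by rewrite (ipJ IP y (delta a)) l2inner_basis mulrC.
Qed.

Lemma coproj_idem a x : coproj a (coproj a x) = coproj a x.
Proof. by rewrite [in LHS](coprojE a x) bopB bopZ coproj_delta scaler0 subr0. Qed.

Lemma coproj_inner a x : l2inner (coproj a x) x = ofR (l2norm (coproj a x) ^+ 2).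
Proof. by rewrite -coproj_idem coproj_sym coproj_idem (ipxx IP). Qed.

(** Let [q] be the projection off a basis vector [e]. The operator [T q] is a
    corner of a positive block with diagonal entries [c] and [c q], which [phi]
    fixes. The image block is positive and its second diagonal entry kills [e],
    so the corner [phi (T q)] kills [e] too; likewise [phi (q T)] has no
    component along [e]. Hence the matrix coefficients of [phi T] are those of
    [phi] applied to a multiple of a matrix unit. *)
Lemma fixes_matunits_id (phi : bop -> bop) :
  completely_positive phi -> phi bop1 = bop1 ->
  (forall a b, phi (matunit a b) = matunit a b) -> forall T, phi T = T.
Proof.
move=> [phil phicp] phi1 phiE.
have {}phil (a : C) S T : phi (a *: S + T) = a *: phi S + phi T by exact: phil.
have phi0 : phi 0 = 0 by have := phil (-1) 0 0; rewrite scaler0 addr0 scaleN1r addNr.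
have phiZ (a : C) S : phi (a *: S) = a *: phi S by rewrite -[a *: S]addr0 phil phi0 addr0.
have phiD S T : phi (S + T) = phi S + phi T by rewrite -{1}[S]scale1r phil scale1r.
have phiq a : phi (coproj a) = coproj a.
  by rewrite /coproj addrC -scaleN1r phil phi1 phiE scaleN1r addrC.
have phi_block P D D' Q : mx_positive (block P D D' Q) ->
    mx_positive (block (phi P) (phi D) (phi D') (phi Q)).
  move=> /phicp; congr mx_positive.
  by apply/matrixP => i j; rewrite !mxE; case: ifP; case: ifP.
pose m T := Num.sqrt (opnorm T).
have mm T : m T * m T = opnorm T by rewrite -expr2 sqr_sqrtr ?opnorm_ge0.
have scal T S x r : l2inner (S x) x = ofR (r ^+ 2) ->
    l2inner ((ofR (opnorm T) *: S) x) x = ofR ((m T * r) ^+ 2).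
  by move=> h; rewrite bopZE (ipZl IP) h -ofRM exprMn [m T ^+ 2]expr2 mm.
have id_inner x : l2inner (bop1 x) x = ofR (l2norm x ^+ 2) by exact: (ipxx IP).
have right a T : phi (bop_comp T (coproj a)) (delta a) = 0.
  set D := bop_comp _ _; have [D' DD'] := adjoint_exists D.
  have /phi_block :
      mx_positive (block (ofR (opnorm T) *: bop1) D D' (ofR (opnorm T) *: coproj a)).
    apply: (block_positive (p := fun x => m T * l2norm x)
                           (q := fun y => m T * l2norm (coproj a y)) DD').
    - by move=> x; apply: scal.
    - by move=> y; apply: scal; exact: coproj_inner.
    - move=> x y; rewrite mulrACA mm /D bop_compE.
      apply: (le_trans (le_ip_nrm IP _ _)); rewrite (mulrC (l2norm x)) [leRHS]mulrA.
      by rewrite ler_wpM2r ?l2norm_ge0//; exact: le_opnorm.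
  rewrite !phiZ phi1 phiq => Bpos; apply: l2_ext => g.
  have := @mx_positive_CS R X 2 _ (pair_vec 0 (delta a)) (pair_vec (delta g) 0) Bpos.
  rewrite !block_inner !bop0 !add0r (ip0r IP) bopZE coproj_delta scaler0 (ip0l IP) addr0.
  by rewrite (ip0r IP) addr0 l2inner_basis; apply.
have left b T x : phi (bop_comp (coproj b) T) x b = 0.
  set D := bop_comp _ _; have [D' DD'] := adjoint_exists D.
  have /phi_block :
      mx_positive (block (ofR (opnorm T) *: coproj b) D D' (ofR (opnorm T) *: bop1)).
    apply: (block_positive (p := fun x => m T * l2norm (coproj b x))
                           (q := fun y => m T * l2norm y) DD').
    - by move=> y; apply: scal; exact: coproj_inner.
    - by move=> y; apply: scal.
    - move=> y z; rewrite mulrACA mm /D bop_compE coproj_sym.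
      apply: (le_trans (le_ip_nrm IP _ _)).
      rewrite [X in _ <= _ * X]mulrC [leRHS]mulrA.
      by rewrite ler_wpM2r ?l2norm_ge0//; exact: le_opnorm.
  rewrite !phiZ phi1 phiq => Bpos.
  have := @mx_positive_CSr 2 _ (pair_vec 0 x) (pair_vec (delta b) 0) Bpos.
  rewrite !block_inner !bop0 !add0r (ip0r IP) bopZE coproj_delta scaler0 !addr0 (ip0l IP).
  by rewrite (ip0r IP) addr0 l2inner_basis; apply.
move=> T; apply: basis_dense => a b.
have -> : T = bop_comp T (matunit a a) + bop_comp T (coproj a).
  by apply: bop_ext => x; rewrite bopDE !bop_compE /coproj bopBE bopB addrC subrK.
rewrite phiD !bopDE right addr0 [bop_comp T (coproj a) _]bop_compE coproj_delta bop0 addr0.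
set S := bop_comp T _.
have E : S = T (delta a) b *: matunit b a + bop_comp (coproj b) S.
  apply: bop_ext => x; rewrite bopDE bopZE bop_compE coprojE /S bop_compE !matunitE bopZ.
  by rewrite l2Z scalerA (mulrC (x a)) addrC subrK.
have -> : phi S (delta a) b = (T (delta a) b *: matunit b a) (delta a) b.
  by rewrite {1}E phiD bopDE l2D left addr0 phiZ phiE.
rewrite bopZE matunitE !deltaE eqxx scale1r l2Z deltaE eqxx mulr1.
by rewrite /S bop_compE matunitE deltaE eqxx scale1r.
Qed.

End MatrixUnits.

(** * The injective envelope of the orbit algebra *)

Section MainTheorem.
Context {R : realType} {G : groupType}.
Local Notation C := (Cplx R).
Local Notation l2 := (l2 R G).
Local Notation bop := (bop R G).
Variable w : beta G.
Local Notation Aw := (@orbit_algebra R G w).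

Lemma orbit_algebra1 : Aw bop1.
Proof. by exists bop1; [exact: crossed1|exact: pi1]. Qed.

Lemma indicator_bounded (A : set G) : bounded_function (fun g => (\1_A g : R)%:C%C : C).
Proof.
exists 1 => g; rewrite -[_%:C%C]/(ofR _) cabs_ofR indicE.
by case: (g \in A); rewrite ?normr1 ?normr0.
Qed.

(** If [A] belongs to [w] but to no other point of its orbit, the indicator of
    [a A] is sent by [pi_w] to the indicator of [a]. *)
Lemma non_recurrent_matunit : non_recurrent w -> forall a b, Aw (matunit a b).
Proof.
move=> [U [oU Uw Ug]] a b.
have [D _ UE] : exists2 D : set (set G), D `<=` setT & \bigcup_(i in D) beta_base i = U := oU.
move: Uw Ug; rewrite -UE => -[A DA wA] Ug.
have {}Ug g : g <> 1%g -> ~ ufilter (beta_act g w) A.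
  by move=> /Ug H gA; apply: H; exists A.
pose f := Linf (indicator_bounded [set k | A (a^-1 * k)%g]).
have fE h : pi_fun w f h = (h == a)%:R.
  have FW := ufilterP w.
  apply: (@cvgC_unique R G (ufilter w) _ _ _ _ (@cvg_pi_fun R G w f h)).
  apply/cvgCP => e e0.
  suff : ufilter w [set k | f (h * k)%g = (h == a)%:R].
    by apply: ufilterS => k /= ->; rewrite subrr cabs0.
  case: eqVneq => [->|ha].
    apply: ufilterS wA => k Ak /=.
    by rewrite indicE mem_set//= mulKg.
  have nh : (a^-1 * h)%g <> 1%g.
    by move=> E; move/eqP: ha; apply; rewrite -[h](mulVKg a) E mulg1.
  apply: (@ufilterS G w (~` [set k | A (a^-1 * h * k)%g])) => [k nA /=|].
    by rewrite indicE memNset//= mulgA.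
  exact: (ufilterC (Ug _ nh)).
exists (bop_comp (mulop f) (lreg (a * b^-1)%g)).
  by have [_ Cm _ _] := @crossed_cstar R G; apply: Cm;
    [exact: crossed_mulop|exact: crossed_lreg].
rewrite pi_mulop_lreg; apply: bop_ext => x; apply: l2_ext => h.
rewrite bop_compE matunitE l2Z deltaE -[LHS]/(pi_fun w f h * x ((a * b^-1)^-1 * h)%g) fE.
case: eqVneq => [->|_]; last by rewrite mul0r mulr0.
by rewrite mul1r mulr1 invgM invgK -mulgA mulVg mulg1.
Qed.

Lemma is_projection_id (A : set bop) : is_projection A id.
Proof.
split=> //; split=> [a S T//|n T Tpos].
by rewrite (_ : map_mx id T = T)//; apply/matrixP => i j; rewrite mxE.
Qed.

Lemma non_recurrent_envelope :
  non_recurrent w -> is_injective_envelope Aw [set: bop].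
Proof.
move=> /non_recurrent_matunit Aunit; exists id; split.
  split; first exact: is_projection_id.
  move=> psi [cp _ fx] _; apply/funext.
  apply: fixes_matunits_id => // [|a b]; apply: fx; [exact: orbit_algebra1|exact: Aunit].
exists id; split=> //; split=> [//|n T _|].
  by congr mx_opnorm; apply/matrixP => i j; rewrite mxE.
by rewrite image_id; apply/seteqP; split=> // T _; exists T.
Qed.

(** See the introduction for the projection [inv Phi Psi phi] below [phi]. *)
Lemma envelope_rigid (A : set bop) (Phi : bop -> bop) : A bop1 ->
  is_injective_envelope A [set: bop] -> is_projection A Phi -> Phi = id.
Proof.
move=> A1 [phi [[[phi_cp phi2 phiA] phi_min] [Psi [[Psil Psi_iso Psi_onto] PsiA]]]].
move=> [Phi_cp Phi2 PhiA].
have [phil phi_pos] := phi_cp; have [Phil Phi_pos] := Phi_cp.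
set E := range phi in Psil Psi_iso Psi_onto.
have Ephi T : E T -> phi T = T.
  by move=> [S _ <-]; rewrite -[LHS]/((phi \o phi) S) phi2.
have AE T : A T -> E T by move=> AT; exists T => //; exact: phiA.
have El (a : C) S T : E S -> E T -> E (a *: S + T).
  by move=> /Ephi ES /Ephi ET; exists (a *: S + T) => //; rewrite phil ES ET.
have E1 : E bop1 by exact: AE.
have E0 : E 0 by have := El (-1) _ _ E1 E1; rewrite scaleN1r addNr.
have Psi1 : Psi bop1 = bop1 by exact: PsiA.
have Psi0 : Psi 0 = 0 by have := Psil (-1) 0 0 E0 E0; rewrite scaler0 addr0 scaleN1r addNr.
have norm0 T : mx_opnorm (const_mx T : 'M[bop]_1) <= 0 -> T = 0.
  move=> T0; apply: bop_ext => x; apply: l2norm_eq0; apply/le_anti.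
  rewrite l2norm_ge0 andbT.
  have := le_mx_opnorm (const_mx T : 'M[bop]_1) (fun=> x).
  move=> h; apply: (@le_trans _ _ (tuple_norm (mx_app (const_mx T : 'M[bop]_1) (fun=> x)))).
    rewrite -(@ler_sqr R) ?nnegrE ?l2norm_ge0 ?sqrtr_ge0// tuple_norm_sqr big_ord1.
    by rewrite /mx_app big_ord1 mxE.
  by apply: (le_trans h); rewrite mulr_le0_ge0 ?sqrtr_ge0.
have Psi_inj S T : E S -> E T -> Psi S = Psi T -> S = T.
  move=> ES ET ST; apply/eqP; rewrite -subr_eq0; apply/eqP/norm0.
  have EST : E (S - T) by rewrite addrC -scaleN1r; exact: El.
  rewrite -(Psi_iso 1%N); last by move=> i j; rewrite mxE.
  have -> : map_mx Psi (const_mx (S - T)) = (const_mx 0 : 'M[bop]_1).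
    apply/matrixP => i j; rewrite !mxE addrC -scaleN1r Psil// ST.
    by rewrite scaleN1r addNr.
  apply: mx_opnorm_le => // x; rewrite mul0r.
  have -> : mx_app (const_mx 0 : 'M[bop]_1) x = 0.
    by apply/funext => i; rewrite /mx_app big1// => j _; rewrite mxE.
  by rewrite (nrm0 (@tuple_inner_space R G 1)).
have inv_ex T : exists S, E S /\ Psi S = T.
  by have : (Psi @` E) T by [rewrite Psi_onto]; move=> [S ES <-]; exists S.
have [inv invP] := choice inv_ex.
have invE T : E (inv T) by have [] := invP T.
have Psi_inv T : Psi (inv T) = T by have [] := invP T.
have inv_Psi T : E T -> inv (Psi T) = T by move=> ET; apply: Psi_inj.
have invl (a : C) S T : inv (a *: S + T) = a *: inv S + inv T.
  by apply: Psi_inj; rewrite ?Psil ?Psi_inv//; exact: El.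
have Psi_pos n (T : 'M[bop]_n) : (forall i j, E (T i j)) ->
    mx_positive T -> mx_positive (map_mx Psi T).
  move=> ET; apply: (unital_contraction_positive El E1 Psil Psi1) => // T' ET'.
  by rewrite Psi_iso.
have inv_pos n (T : 'M[bop]_n) : mx_positive T -> mx_positive (map_mx inv T).
  apply: (@unital_contraction_positive R G setT inv) => //.
    by rewrite -{1}Psi1 inv_Psi.
  move=> T' _; rewrite -(Psi_iso _ (map_mx inv T')); last by move=> i j; rewrite mxE.
  rewrite (_ : map_mx Psi _ = T')//.
  by apply/matrixP => i j; rewrite !mxE.
pose psi := inv \o Phi \o Psi \o phi.
have Ep T : E (phi T) by exists T.
have psiP : is_projection A psi.
  split.
  - split=> [a S T|n T Tpos]; first by rewrite /psi /= phil Psil// Phil invl.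
    have -> : map_mx psi T = map_mx inv (map_mx Phi (map_mx Psi (map_mx phi T))).
      by apply/matrixP => i j; rewrite !mxE.
    apply/inv_pos/Phi_pos/Psi_pos; last exact: phi_pos.
    by move=> i j; rewrite mxE.
  - apply/funext => T; rewrite /psi /= (Ephi _ (invE _)) Psi_inv.
    by congr inv; rewrite -[LHS]/((Phi \o Phi) _) Phi2.
  - move=> T AT; rewrite /psi /= phiA// PsiA// PhiA//.
    by rewrite -{1}(PsiA T AT) inv_Psi//; exact: AE.
have psi_le : projection_le psi phi.
  split; apply/funext => T; rewrite /psi /=; last by rewrite (Ephi _ (invE _)).
  by rewrite (Ephi _ (Ep T)).
have psiE := phi_min _ psiP psi_le.
apply/funext => T; have := congr1 (fun f => Psi (f (inv T))) psiE.
by rewrite /psi /= !(Ephi _ (invE T)) !Psi_inv.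
Qed.

(** The coefficient at the identity of the translate by [h] of the rank one
    projection there vanishes unless [h] is the identity. *)
Lemma envelope_non_recurrent : no_nontrivial_finite_subgroup G ->
  is_injective_envelope Aw [set: bop] -> non_recurrent w.
Proof.
move=> Gtf env; apply: contrapT => /(recurrent_idempotent Gtf)[e [ee ew e1]].
have eP : is_projection Aw (tlim e).
  split; first exact: tlim_cp.
    by apply/funext => T; rewrite /= tlim_bmul ee.
  by apply: tlim_fixes_orbit => f; apply/funext => g; rewrite pi_fun_bmul ew.
have E : (tlim e (matunit 1%g 1%g) (delta 1%g) 1%g : C) = 1.
  have -> : tlim e (matunit 1%g 1%g) = matunit 1%g 1%g :> bop.
    by rewrite (envelope_rigid orbit_algebra1 env eP).
  by rewrite matunitE l2Z !deltaE eqxx mulr1.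
have FE := ufilterP e.
pose F (h : G) : C := matunit 1%g 1%g (rreg h (delta 1%g)) (1 * h)%g.
have F0 (h : G) : h <> 1%g -> F h = 0.
  move=> h1; rewrite /F matunitE l2Z deltaE mul1g.
  by case: eqP => // _; rewrite mulr0.
have : (0 : C) = 1.
  apply: (@cvgC_unique R G (ufilter e) _ F); last first.
    by rewrite -[X in _ --> X]E; exact: cvg_tlim.
  apply/cvgCP => d d0; apply: ufilterS (ufilterC e1) => h h1.
  by rewrite -[X in cabs (X - _)]/(F h) F0// subrr cabs0.
by move/esym/eqP; rewrite oner_eq0.
Qed.
End MainTheorem.

Theorem corollary21 (R : realType) (G : groupType) (w : beta G) :
  countable [set: G] -> no_nontrivial_finite_subgroup G ->
  (is_injective_envelope (orbit_algebra w) [set: bop R G] <-> non_recurrent w).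
Proof.
move=> _ Gtf; split; first exact: envelope_non_recurrent.
exact: non_recurrent_envelope.
Qed.
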